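(* Let $\Bbbk$ be a field and let $\Lambda$ be a graded AS Gorenstein $\Bbbk$-algebra of graded injective dimension $n$, with graded Jacobson radical $m=\Lambda_{\geq 1}$. Assume that all graded simple $\Lambda$-modules (left and right) have projective resolutions consisting of finitely generated projective modules, and that $\Lambda$ has finite left local cohomology dimension. Then for every graded left $\Lambda$-module $M$ and every integer $i$ with $0\leq i\leq n$ there is a natural isomorphism $$D\bigl(\varinjlim_{k}\mathrm{Ext}_{\Lambda}^{i}(\Lambda/\Lambda_{\geq k},M)\bigr)\cong \mathrm{Ext}_{\Lambda}^{n-i}\bigl(M,D(\Gamma_{m}^{n}(\Lambda))\bigr).$$
   Context: All algebras $\Lambda$ are locally finite positively graded $\Bbbk$-algebras: $\Lambda=\bigoplus_{i\geq 0}\Lambda_i$ with $\Lambda_0=\Bbbk\times\cdots\times\Bbbk$ (a finite product) and $\dim_{\Bbbk}\Lambda_i<\infty$ for all $i$. Put $\Lambda_{\geq k}=\bigoplus_{j\geq k}\Lambda_j$; the graded Jacobson radical is $m=\Lambda_{\geq 1}$. Right $\Lambda$-modules are identified with $\Lambda^{op}$-modules. For a $\mathbb{Z}$-graded module $M$, the shift $M[d]$ is given by $M[d]_i=M_{d+i}$. For graded modules $M,N$, $\mathrm{Hom}_\Lambda(M,N)_d$ is the set of homomorphisms $f$ with $f(M_j)\subseteq N_{j+d}$ for all $j$, and $\mathrm{Hom}_\Lambda(M,N)=\bigoplus_{d\in\mathbb{Z}}\mathrm{Hom}_\Lambda(M,N)_d$. $\mathrm{Ext}^k_\Lambda(-,-)_0$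 denotes the derived functors of $\mathrm{Hom}_\Lambda(-,-)_0$ on the category of graded modules and degree-zero maps, $\mathrm{Ext}^k_\Lambda(M,N)_d=\mathrm{Ext}^k_\Lambda(M,N[d])_0$, and $\mathrm{Ext}^k_\Lambda(M,N)=\bigoplus_{d\in\mathbb{Z}}\mathrm{Ext}^k_\Lambda(M,N)_d$. The graded dual is $D(M)_j=\mathrm{Hom}_{\Bbbk}(M_{-j},\Bbbk)$; it interchanges left and right modules. Graded AS Gorenstein: $\Lambda$ is graded Artin–Schelter (AS) Gorenstein if there is a non-negative integer $n$, called the graded injective dimension of $\Lambda$, such that: (i) for every graded simple left $\Lambda$-module $S_i$ concentrated in degree zero and every non-negative integer $j\neq n$, $\mathrm{Ext}_\Lambda^j(S_i,\Lambda)=0$; (ii) for each such $S_i$, $\mathrm{Ext}_\Lambda^n(S_i,\Lambda)\cong S_i'[-n_i]$ for some integer $n_i$ and some graded simple $\Lambda^{op}$-module $S_i'$ (concentrated in degree zero); (iii) $\mathrm{Ext}_{\Lambda^{op}}^k(\mathrm{Ext}_\Lambda^n(S_i,\Lambda),\Lambda)=0$ for every non-negative integer $k\neq n$, and $\mathrm{Ext}_{\Lambda^{op}}^n(\mathrm{Ext}_\Lambda^n(S_i,\Lambda),\Lambda)\cong S_i$. Local cohomology: for a graded left module $M$, $\Gamma_m^i(M)=\varinjlim_k \mathrm{Ext}_\Lambda^i(\Lambda/\Lambda_{\geq k},M)$, the direct limit being induced by the projections $\Lambda/\Lambda_{\geq k}\to\Lambda/\Lambda_{\geq k-1}$. $\Gamma_m^n(\Lambda)$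 carries a natural $\Lambda$-$\Lambda$-bimodule structure, and $D(\Gamma_m^n(\Lambda))$ is regarded as a left $\Lambda$-module via the right $\Lambda$-structure of $\Gamma_m^n(\Lambda)$. $\Lambda$ has finite left local cohomology dimension if there is a non-negative integer $\ell_0$ such that $\Gamma_m^\ell(M)=0$ for every graded left $\Lambda$-module $M$ and every integer $\ell>\ell_0$. *)

(* Defs.v *)
From HB Require Import structures.
From mathcomp Require Import all_boot all_order all_algebra.
From mathcomp Require Import generic_quotient ring_quotient.
From mathcomp Require Import mathcomp_extra boolp classical_sets functions.
From mathcomp Require Import cardinality fsbigop.

Set Implicit Arguments.
Unset Strict Implicit.
Unset Printing Implicit Defensive.

Import GRing.Theory.
Local Open Scope classical_set_scope.
Local Open Scope ring_scope.
Local Open Scope quotient_scope.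

Section VectorSpaces.
Variable k : fieldType.
Implicit Types U V W : lmodType k.

Section LinearFacts.
Variables (U V : lmodType k) (f : U -> V).
Hypothesis fL : linear f.

Lemma lin0 : f 0 = 0.
Proof. by have := fL (-1) 0 0; rewrite scaler0 addr0 scaleN1r addNr. Qed.

Lemma linD u v : f (u + v) = f u + f v.
Proof. by have := fL 1 u v; rewrite !scale1r. Qed.

Lemma linZ c u : f (c *: u) = c *: f u.
Proof. by have := fL c u 0; rewrite lin0 !addr0. Qed.

Lemma linN u : f (- u) = - f u.
Proof. by rewrite -scaleN1r linZ scaleN1r. Qed.

Lemma linB u v : f (u - v) = f u - f v.
Proof. by rewrite linD linN. Qed.

Lemma lin_sum (I : Type) (r : seq I) (P : pred I) (F : I -> U) :
  f (\sum_(i <- r | P i) F i) = \sum_(i <- r | P i) f (F i).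
Proof. exact: (big_morph f linD lin0). Qed.
End LinearFacts.

(* Membership is valued in [Prop]; the classical axioms turn it into a boolean
   predicate below. *)
Record subspace V := Subspace {
  subspace_set :> V -> Prop;
  subspace0 : subspace_set 0;
  subspaceP : forall (c : k) u v,
    subspace_set u -> subspace_set v -> subspace_set (c *: u + v) }.

Section SubQuo.
Variables (V : lmodType k) (S : subspace V).

Definition subspace_pred : {pred V} := fun v => `[< S v >].

Lemma subspace_predP v : reflect (S v) (v \in subspace_pred).
Proof. exact: asboolP. Qed.

Lemma subspace_pred_closed : submod_closed subspace_pred.
Proof.
split; first by apply/subspace_predP; exact: subspace0.
by move=> c u v /subspace_predP Su /subspace_predP Sv; apply/subspace_predP;
  exact: subspaceP.
Qed.

HB.instance Definition _ :=
  GRing.isSubmodClosed.Build k V subspace_pred subspace_pred_closed.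

Record sub_of := SubOf { sub_val : V; _ : sub_val \in subspace_pred }.
HB.instance Definition _ := [isSub for sub_val].
HB.instance Definition _ := [Choice of sub_of by <:].
HB.instance Definition _ := [SubChoice_isSubLmodule of sub_of by <:].

Definition mksub v (Sv : S v) : sub_of := SubOf (introT (subspace_predP v) Sv).

Lemma sub_valP (x : sub_of) : S (sub_val x).
Proof. by apply/subspace_predP; case: x. Qed.

Lemma sub_val_inj : injective sub_val.
Proof. exact: val_inj. Qed.

Lemma sub_val_linear : linear sub_val.
Proof. by []. Qed.

Definition quo_of : Type := Quotient.quot (subspace_pred : zmodClosed V).
HB.instance Definition _ := GRing.Zmodule.on quo_of.
HB.instance Definition _ := EqQuotient.on quo_of.

Definition quo_pi (v : V) : quo_of := \pi_quo_of v.
Definition quo_repr (x : quo_of) : V := repr x.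

Lemma quo_reprK : cancel quo_repr quo_pi.
Proof. exact: reprK. Qed.

Lemma quo_piE u v : quo_pi u = quo_pi v <-> S (u - v).
Proof.
split=> [/eqP|Suv].
  by rewrite -[_ == _]/(\pi_quo_of u == \pi_quo_of v)
    -Quotient.idealrBE => /subspace_predP.
by apply/eqP; rewrite -[_ == _]/(\pi_quo_of u == \pi_quo_of v)
    -Quotient.idealrBE; apply/subspace_predP.
Qed.

Lemma quo_piD u v : quo_pi (u + v) = quo_pi u + quo_pi v.
Proof. by rewrite /quo_pi piE. Qed.

Definition quo_scale (c : k) (x : quo_of) : quo_of := quo_pi (c *: quo_repr x).

Lemma subspaceZ c u : S u -> S (c *: u).
Proof. by move=> Su; rewrite -[c *: u]addr0; apply: subspaceP (subspace0 _). Qed.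

Lemma quo_scaleE c v : quo_scale c (quo_pi v) = quo_pi (c *: v).
Proof.
apply/quo_piE; rewrite -scalerBr; apply: subspaceZ.
by apply/quo_piE; exact: quo_reprK.
Qed.

Fact quo_scaleA a b x : quo_scale a (quo_scale b x) = quo_scale (a * b) x.
Proof. by rewrite -[x]quo_reprK !quo_scaleE scalerA. Qed.
Fact quo_scale1 : left_id 1 quo_scale.
Proof. by move=> x; rewrite -[x]quo_reprK !quo_scaleE scale1r. Qed.
Fact quo_scaleDr : right_distributive quo_scale +%R.
Proof.
move=> a x y; rewrite -[x]quo_reprK -[y]quo_reprK -quo_piD !quo_scaleE.
by rewrite scalerDr quo_piD.
Qed.
Fact quo_scaleDl x : {morph quo_scale^~ x : a b / a + b}.
Proof.
by move=> a b; rewrite -[x]quo_reprK !quo_scaleE scalerDl quo_piD.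
Qed.
HB.instance Definition _ := GRing.Zmodule_isLmodule.Build k quo_of
  quo_scaleA quo_scale1 quo_scaleDr quo_scaleDl.

Lemma quo_pi_linear : linear quo_pi.
Proof. by move=> c u v; rewrite quo_piD -quo_scaleE. Qed.

(* The map induced on the quotient by a linear map that vanishes on [S]; see
   [quo_liftE]. *)
Definition quo_lift W (f : V -> W) (x : quo_of) : W := f (quo_repr x).

Lemma quo_liftE W (f : V -> W) : linear f -> (forall v, S v -> f v = 0) ->
  forall v, quo_lift f (quo_pi v) = f v.
Proof.
move=> fL fS v; apply/eqP; rewrite -subr_eq0 -(linB fL); apply/eqP/fS/quo_piE.
exact: quo_reprK.
Qed.

Lemma quo_lift_linear W (f : V -> W) :
  linear f -> (forall v, S v -> f v = 0) -> linear (quo_lift f).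
Proof.
move=> fL fS c x y; rewrite -[x]quo_reprK -[y]quo_reprK -quo_pi_linear.
by rewrite !quo_liftE // fL.
Qed.
End SubQuo.

Section Dual.
Variable V : lmodType k.

Fact linear_forms0 : linear (0 : V -> k^o).
Proof. by move=> c u v; rewrite /= scaler0 addr0. Qed.

Fact linear_formsP (a : k) (f g : V -> k^o) :
  linear f -> linear g -> linear (a *: f + g).
Proof.
move=> fL gL c u v; rewrite -[LHS]/(a *: f (c *: u + v) + g (c *: u + v)) fL gL.
rewrite -[RHS]/(c *: (a *: f u + g u) + (a *: f v + g v)).
by rewrite !scalerDr !scalerA addrACA mulrC.
Qed.

Definition linear_forms : subspace (V -> k^o) :=
  @Subspace (V -> k^o) (fun f => linear f) linear_forms0 linear_formsP.

Definition dual : lmodType k := sub_of linear_forms.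
End Dual.

Section DualMap.
Variables (V W : lmodType k) (f : V -> W).
Hypothesis fL : linear f.

Fact dual_map_subproof (u : dual W) : linear_forms V (sub_val u \o f).
Proof. by move=> c x y /=; rewrite fL (sub_valP u). Qed.

Definition dual_map (u : dual W) : dual V := mksub (dual_map_subproof u).
End DualMap.

Record dsystem := DSystem {
  dsys :> nat -> lmodType k;
  dtr : forall i j, (i <= j)%N -> dsys i -> dsys j;
  dtr_linear : forall i j (ij : (i <= j)%N), linear (dtr ij);
  dtr_id : forall i (ii : (i <= i)%N) x, dtr ii x = x;
  dtr_comp : forall i j l (ij : (i <= j)%N) (jl : (j <= l)%N) (il : (i <= l)%N) x,
    dtr jl (dtr ij x) = dtr il x }.

Section DirectLimit.
Variable X : dsystem.

Definition dl_pre : Type := {i : nat & X i}.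
HB.instance Definition _ := Choice.on dl_pre.

Definition dl_rel (x y : dl_pre) : bool :=
  `[< exists l (xl : (tag x <= l)%N) (yl : (tag y <= l)%N),
        dtr xl (tagged x) = dtr yl (tagged y) >].

Fact dl_rel_equiv : equiv_class_of dl_rel.
Proof.
split=> [x|x y|y x z].
- by apply/asboolP; exists (tag x), (leqnn _), (leqnn _).
- by apply/asboolP/asboolP => -[l [a [b e]]]; exists l, b, a.
move=> /asboolP[l [a [b e]]] /asboolP[m [c [d e']]]; apply/asboolP.
have lM := leq_maxl l m; have mM := leq_maxr l m.
exists (maxn l m), (leq_trans a lM), (leq_trans d mM).
rewrite -(dtr_comp a lM) e -(dtr_comp d mM) -e'.
by rewrite (dtr_comp b lM (leq_trans b lM)) (dtr_comp c mM (leq_trans b lM)).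
Qed.
Canonical dl_rel_equivRel := EquivRelPack dl_rel_equiv.

Definition dlim : Type := {eq_quot dl_rel}.
HB.instance Definition _ := Choice.on dlim.
HB.instance Definition _ := EqQuotient.on dlim.

Definition dl_in i (x : X i) : dlim := \pi_dlim (@Tagged _ i (fun j => X j) x : dl_pre).

Lemma dl_inE i j (x : X i) (y : X j) : dl_in x = dl_in y <->
  exists l (il : (i <= l)%N) (jl : (j <= l)%N), dtr il x = dtr jl y.
Proof.
split=> [/eqP|H]; first by rewrite /dl_in piE => /asboolP.
by apply/eqP; rewrite /dl_in piE; apply/asboolP.
Qed.

Lemma dl_in_tr i j (ij : (i <= j)%N) (x : X i) : dl_in (dtr ij x) = dl_in x.
Proof.
by apply/dl_inE; exists j, (leqnn j), ij; rewrite dtr_id.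
Qed.

Lemma dl_inP (x : dlim) : exists i (u : X i), x = dl_in u.
Proof. by exists (tag (repr x)), (tagged (repr x)); rewrite -[LHS]reprK; case: (repr x). Qed.

Lemma dl_inP2 (x y : dlim) : exists i (u v : X i), x = dl_in u /\ y = dl_in v.
Proof.
have [i [u ->]] := dl_inP x; have [j [v ->]] := dl_inP y.
exists (maxn i j), (dtr (leq_maxl i j) u), (dtr (leq_maxr i j) v).
by rewrite !dl_in_tr.
Qed.

Lemma dl_inP3 (x y z : dlim) :
  exists i (u v w : X i), [/\ x = dl_in u, y = dl_in v & z = dl_in w].
Proof.
have [i [u [v [-> ->]]]] := dl_inP2 x y; have [j [w ->]] := dl_inP z.
exists (maxn i j), (dtr (leq_maxl i j) u), (dtr (leq_maxl i j) v),
  (dtr (leq_maxr i j) w).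
by rewrite !dl_in_tr.
Qed.

Definition dl_zero : dlim := dl_in (0 : X 0%N).
Definition dl_opp (x : dlim) : dlim := dl_in (- tagged (repr x)).
Definition dl_scale (c : k) (x : dlim) : dlim := dl_in (c *: tagged (repr x)).
Definition dl_add (x y : dlim) : dlim :=
  dl_in (dtr (leq_maxl (tag (repr x)) (tag (repr y))) (tagged (repr x))
       + dtr (leq_maxr (tag (repr x)) (tag (repr y))) (tagged (repr y))).

Lemma dl_in_repr i (u : X i) : exists l (a : (tag (repr (dl_in u)) <= l)%N)
  (b : (i <= l)%N), dtr a (tagged (repr (dl_in u))) = dtr b u.
Proof.
have : dl_in (tagged (repr (dl_in u))) = dl_in u.
  by rewrite -[RHS]reprK /dl_in; case: (repr _).
by move/dl_inE.
Qed.

Lemma dl_in0 i : dl_in (0 : X i) = dl_zero.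
Proof.
apply/dl_inE; exists i, (leqnn i), (leq0n i).
by rewrite !(lin0 (@dtr_linear X _ _ _)).
Qed.

Lemma dl_inN i (u : X i) : dl_opp (dl_in u) = dl_in (- u).
Proof.
have [l [a [b e]]] := dl_in_repr u; apply/dl_inE; exists l, a, b.
by rewrite !(linN (@dtr_linear X _ _ _)) e.
Qed.

Lemma dl_inZ i c (u : X i) : dl_scale c (dl_in u) = dl_in (c *: u).
Proof.
have [l [a [b e]]] := dl_in_repr u; apply/dl_inE; exists l, a, b.
by rewrite !(linZ (@dtr_linear X _ _ _)) e.
Qed.

Lemma dl_inD i (u v : X i) : dl_add (dl_in u) (dl_in v) = dl_in (u + v).
Proof.
have [l [a [b e]]] := dl_in_repr u; have [m [c [d f]]] := dl_in_repr v.
have lM := leq_maxl l m; have mM := leq_maxr l m.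
set p := maxn l m in lM mM.
have xp : (maxn (tag (repr (dl_in u))) (tag (repr (dl_in v))) <= p)%N.
  by rewrite geq_max (leq_trans a lM) (leq_trans c mM).
apply/dl_inE; exists p, xp, (leq_trans b lM).
rewrite !(linD (@dtr_linear X _ _ _)).
rewrite (dtr_comp _ _ (leq_trans a lM)) -(dtr_comp a lM) e.
rewrite (dtr_comp _ _ (leq_trans c mM)) -(dtr_comp c mM) f.
by rewrite (dtr_comp b lM (leq_trans b lM)) (dtr_comp d mM (leq_trans b lM)).
Qed.

Fact dl_addA : associative dl_add.
Proof.
by move=> x y z; have [i [u [v [w [-> -> ->]]]]] := dl_inP3 x y z;
  rewrite !dl_inD addrA.
Qed.
Fact dl_addC : commutative dl_add.
Proof.
by move=> x y; have [i [u [v [-> ->]]]] := dl_inP2 x y; rewrite !dl_inD addrC.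
Qed.
Fact dl_add0 : left_id dl_zero dl_add.
Proof.
by move=> x; have [i [u ->]] := dl_inP x; rewrite -(dl_in0 i) dl_inD add0r.
Qed.
Fact dl_addN : left_inverse dl_zero dl_opp dl_add.
Proof.
by move=> x; have [i [u ->]] := dl_inP x; rewrite dl_inN dl_inD addNr dl_in0.
Qed.
HB.instance Definition _ :=
  GRing.isZmodule.Build dlim dl_addA dl_addC dl_add0 dl_addN.

Fact dl_scaleA a b x : dl_scale a (dl_scale b x) = dl_scale (a * b) x.
Proof. by have [i [u ->]] := dl_inP x; rewrite !dl_inZ scalerA. Qed.
Fact dl_scale1 : left_id 1 dl_scale.
Proof. by move=> x; have [i [u ->]] := dl_inP x; rewrite dl_inZ scale1r. Qed.
Fact dl_scaleDr : right_distributive dl_scale +%R.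
Proof.
move=> a x y; have [i [u [v [-> ->]]]] := dl_inP2 x y.
by rewrite -[_ + _]/(dl_add _ _) -[RHS]/(dl_add _ _) dl_inD !dl_inZ dl_inD scalerDr.
Qed.
Fact dl_scaleDl x : {morph dl_scale^~ x : a b / a + b}.
Proof.
move=> a b; have [i [u ->]] := dl_inP x.
by rewrite -[RHS]/(dl_add _ _) !dl_inZ dl_inD scalerDl.
Qed.
HB.instance Definition _ := GRing.Zmodule_isLmodule.Build k dlim
  dl_scaleA dl_scale1 dl_scaleDr dl_scaleDl.

Lemma dl_in_linear i : linear (@dl_in i).
Proof.
move=> c u v; rewrite -[RHS]/(dl_add (dl_scale _ _) _).
by rewrite dl_inZ dl_inD.
Qed.
End DirectLimit.

(* The map induced on direct limits by a morphism of direct systems; see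
   [dl_mapE]. *)
Definition dl_map (X Y : dsystem) (f : forall i, X i -> Y i) (x : dlim X) :
  dlim Y := dl_in (f _ (tagged (repr x))).

Lemma dl_mapE (X Y : dsystem) (f : forall i, X i -> Y i) :
  (forall i j (ij : (i <= j)%N) x, f j (dtr ij x) = dtr ij (f i x)) ->
  forall i (u : X i), dl_map f (dl_in u) = dl_in (f i u).
Proof.
move=> fC i u; have [l [a [b e]]] := dl_in_repr u.
by apply/dl_inE; exists l, a, b; rewrite -!fC e.
Qed.

Lemma dl_map_linear (X Y : dsystem) (f : forall i, X i -> Y i) :
  (forall i, linear (f i)) ->
  (forall i j (ij : (i <= j)%N) x, f j (dtr ij x) = dtr ij (f i x)) ->
  linear (dl_map f).
Proof.
move=> fL fC c x y; have [i [u [v [-> ->]]]] := dl_inP2 x y.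
by rewrite -dl_in_linear !dl_mapE // fL dl_in_linear.
Qed.
End VectorSpaces.

(* A locally finite positively graded algebra whose degree-zero part is a
   finite product of copies of [k]. [hcomp i] is the projection onto the
   component of degree [i], which is therefore [[set a | hcomp i a = a]]. *)
Record galg (k : fieldType) := GAlg {
  galg_sort :> algType k;
  hcomp : nat -> galg_sort -> galg_sort;
  hcomp_linear : forall i, linear (hcomp i);
  hcomp_hcomp : forall i j a,
    hcomp i (hcomp j a) = if i == j then hcomp j a else 0;
  hcomp_sum : forall a, exists n, a = \sum_(i < n) hcomp i a;
  hcomp1 : hcomp 0 1 = 1;
  hcompM : forall i j a b, hcomp i a = a -> hcomp j b = b ->
    hcomp (i + j) (a * b) = a * b;
  hcomp_fin : forall i, exists s : seq galg_sort, forall a, hcomp i a = a ->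
    exists c : nat -> k, a = \sum_(j < size s) c j *: s`_j;
  hcomp0_split : exists (r : nat) (f : {ffun 'I_r -> k^o} -> galg_sort),
    [/\ linear f,
        injective f,
        forall a, hcomp 0 a = a <-> exists c, f c = a,
        forall c d : {ffun 'I_r -> k^o}, f [ffun i => c i * d i] = f c * f d
      & f [ffun=> 1] = 1] }.

Section GradedAlgebra.
Variables (k : fieldType) (A : galg k).

(* Components in arbitrary integer degrees; those of negative degree are 0. *)
Definition zcomp (z : int) (a : A) : A :=
  match z with Posz i => hcomp i a | Negz _ => 0 end.

Lemma zcomp_linear z : linear (zcomp z).
Proof.
by case: z => i /=; [exact: hcomp_linear | move=> c a b; rewrite scaler0 addr0].
Qed.

Definition homog (z : int) (a : A) : Prop := zcomp z a = a.

Lemma zcompK z a : homog z (zcomp z a).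
Proof. by case: z => i; rewrite /homog //= hcomp_hcomp eqxx. Qed.

Lemma homog0 z : homog z 0.
Proof. exact: lin0 (zcomp_linear z). Qed.

Lemma homogP z c a b : homog z a -> homog z b -> homog z (c *: a + b).
Proof. by rewrite /homog zcomp_linear => -> ->. Qed.

Definition homog_space z : subspace A :=
  @Subspace _ A (homog z) (homog0 z) (@homogP z).

Lemma homog1 : homog 0 1.
Proof. exact: hcomp1. Qed.

Lemma homogM x y a b : homog x a -> homog y b -> homog (x + y) (a * b).
Proof.
case: x y => [i|i] [j|j] xa yb; first exact: hcompM.
- by rewrite -yb mulr0; exact: homog0.
- by rewrite -xa mul0r; exact: homog0.
- by rewrite -xa mul0r; exact: homog0.
Qed.
End GradedAlgebra.

(* Right modules over [A] are left modules over the opposite algebra. Both are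
   treated at once: [smul Rgt] is the multiplication of the opposite algebra. *)
Variant side := Lft | Rgt.
Definition opp_side s := match s with Lft => Rgt | Rgt => Lft end.

Definition smul (R : pzRingType) (s : side) (a b : R) : R :=
  match s with Lft => a * b | Rgt => b * a end.

Section SMul.
Variables (k : fieldType) (A : galg k) (s : side).
Implicit Types a b c : A.

Lemma smulA a b c : smul s a (smul s b c) = smul s (smul s a b) c.
Proof. by case: s => /=; rewrite mulrA. Qed.
Lemma smul1r a : smul s 1 a = a.
Proof. by case: s => /=; rewrite (mul1r, mulr1). Qed.
Lemma smulr1 a : smul s a 1 = a.
Proof. by case: s => /=; rewrite (mul1r, mulr1). Qed.
Lemma smul_linear_l b : linear (fun a => smul s a b).
Proof.
by move=> c u v; case: s => /=; [rewrite mulrDl scalerAl|rewrite mulrDr scalerAr].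
Qed.
Lemma smul_linear_r a : linear (smul s a).
Proof.
by move=> c u v; case: s => /=; [rewrite mulrDr scalerAr|rewrite mulrDl scalerAl].
Qed.
Lemma smul_opp a b : smul (opp_side s) a b = smul s b a.
Proof. by case: s. Qed.
Lemma homog_smul x y a b : homog x a -> homog y b -> homog (x + y) (smul s a b).
Proof.
by case: s => xa yb; [exact: homogM | rewrite addrC; exact: homogM].
Qed.
End SMul.

(* A Z-graded module, given by its homogeneous components. For [x] in [M j],
   [gact j l a x] is the product of [x] by the component of degree [l - j] of
   [a]; it lies in [M l]. Indexing the action by its source and target degrees
   avoids any transport along equalities between degrees. *)
Record gmod (k : fieldType) (s : side) (A : galg k) := GMod {
  gpiece :> int -> lmodType k;
  gact : forall j l, A -> gpiece j -> gpiece l;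
  gact_linear_l : forall j l x, linear (fun a => @gact j l a x);
  gact_linear_r : forall j l a, linear (@gact j l a);
  gact1 : forall j x, @gact j j 1 x = x;
  gactM : forall j l p a b x, @gact l p a (@gact j l b x) =
    @gact j p (smul s (zcomp (p - l) a) (zcomp (l - j) b)) x }.
Arguments gact {k s A} M j l a x : rename.

(* Degree-zero homomorphisms. Those of degree [d] are the degree-zero ones into
   [shift N d]. *)
Record gmor (k : fieldType) (s : side) (A : galg k) (M N : gmod s A) := GMor {
  gm :> forall j, M j -> N j;
  gm_linear : forall j, linear (@gm j);
  gm_act : forall j l a x, @gm l (gact M j l a x) = gact N j l a (@gm j x) }.
Arguments gm {k s A M N} f j x : rename.

Section GradedModules.
Variables (k : fieldType) (s : side) (A : galg k).
Implicit Types M N P : gmod s A.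

Lemma gactE M j l a x : gact M j l (zcomp (l - j) a) x = gact M j l a x.
Proof.
rewrite -[RHS]gact1 gactM subrr (homog1 A) smul1r.
by congr gact.
Qed.

Lemma gmor_ext M N (f g : gmor M N) : (forall j x, f j x = g j x) -> f = g.
Proof.
case: f g => [f fL fA] [g gL gA] /= fg.
have e : f = g by apply: functional_extensionality_dep => j; apply/funext/fg.
by case: g / e gL gA {fg} => gL gA; congr GMor; exact: Prop_irrelevance.
Qed.

Definition gid M : gmor M M :=
  @GMor k s A M M (fun j x => x) (fun j c u v => erefl) (fun j l a x => erefl).

Section Comp.
Variables (M N P : gmod s A) (g : gmor N P) (f : gmor M N).
Fact gcomp_linear j : linear (fun x => g j (f j x)).
Proof. by move=> c u v; rewrite !gm_linear. Qed.
Fact gcomp_act j l a x :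
  g l (f l (gact M j l a x)) = gact P j l a (g j (f j x)).
Proof. by rewrite !gm_act. Qed.
Definition gcomp : gmor M P := GMor gcomp_linear gcomp_act.
End Comp.

Section Hom.
Variables M N : gmod s A.
HB.instance Definition _ := gen_eqMixin (gmor M N).
HB.instance Definition _ := gen_choiceMixin (gmor M N).
Implicit Types f g : gmor M N.

Fact gzero_linear j : linear (fun _ : M j => 0 : N j).
Proof. by move=> c u v; rewrite scaler0 addr0. Qed.
Fact gzero_act j l a (x : M j) : 0 = gact N j l a 0.
Proof. by rewrite (lin0 (@gact_linear_r _ _ _ _ _ _ _)). Qed.
Definition gzero : gmor M N := GMor gzero_linear gzero_act.

Fact glin_linear (c : k) f g j : linear (fun x => c *: f j x + g j x).
Proof.
by move=> d u v; rewrite !gm_linear !scalerDr !scalerA addrACA mulrC.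
Qed.
Fact glin_act (c : k) f g j l a (x : M j) :
  c *: f l (gact M j l a x) + g l (gact M j l a x) =
  gact N j l a (c *: f j x + g j x).
Proof. by rewrite !gm_act gact_linear_r. Qed.
Definition glin (c : k) f g : gmor M N := GMor (glin_linear c f g) (glin_act c f g).

Definition gadd f g : gmor M N := glin 1 f g.
Definition gopp f : gmor M N := glin (-1) f gzero.
Definition gscale (c : k) f : gmor M N := glin c f gzero.

Fact gaddA : associative gadd.
Proof. by move=> f g h; apply: gmor_ext => j x /=; rewrite !scale1r addrA. Qed.
Fact gaddC : commutative gadd.
Proof. by move=> f g; apply: gmor_ext => j x /=; rewrite !scale1r addrC. Qed.
Fact gadd0 : left_id gzero gadd.
Proof. by move=> f; apply: gmor_ext => j x /=; rewrite !scale1r add0r. Qed.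
Fact gaddN : left_inverse gzero gopp gadd.
Proof.
by move=> f; apply: gmor_ext => j x /=; rewrite scale1r scaleN1r addr0 addNr.
Qed.
HB.instance Definition _ :=
  GRing.isZmodule.Build (gmor M N) gaddA gaddC gadd0 gaddN.

Fact gscaleA a b f : gscale a (gscale b f) = gscale (a * b) f.
Proof. by apply: gmor_ext => j x /=; rewrite !addr0 scalerA. Qed.
Fact gscale1 : left_id 1 gscale.
Proof. by move=> f; apply: gmor_ext => j x /=; rewrite scale1r addr0. Qed.
Fact gscaleDr : right_distributive gscale +%R.
Proof.
by move=> a f g; apply: gmor_ext => j x /=; rewrite !addr0 !scale1r scalerDr.
Qed.
Fact gscaleDl f : {morph gscale^~ f : a b / a + b}.
Proof.
by move=> a b; apply: gmor_ext => j x /=; rewrite !addr0 !scale1r scalerDl.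
Qed.
HB.instance Definition _ := GRing.Zmodule_isLmodule.Build k (gmor M N)
  gscaleA gscale1 gscaleDr gscaleDl.

Lemma gmor0E j x : (0 : gmor M N) j x = 0.
Proof. by []. Qed.
Lemma gmorPE c f g j x : (c *: f + g) j x = c *: f j x + g j x.
Proof. by rewrite /= addr0 scale1r. Qed.
End Hom.

(* [shift M d] is M[d]. *)
Section Shift.
Variables (M : gmod s A) (d : int).

Fact shift_deg (j l : int) : (d + l) - (d + j) = l - j.
Proof. by rewrite opprD addrACA subrr add0r. Qed.
Fact shift_actM j l p a b x :
  gact M (d + l) (d + p) a (gact M (d + j) (d + l) b x) =
  gact M (d + j) (d + p) (smul s (zcomp (p - l) a) (zcomp (l - j) b)) x.
Proof. by rewrite gactM !shift_deg. Qed.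
Definition shift : gmod s A :=
  @GMod k s A (fun j => M (d + j)) (fun j l => gact M (d + j) (d + l))
    (fun j l => @gact_linear_l _ _ _ M (d + j) (d + l))
    (fun j l => @gact_linear_r _ _ _ M (d + j) (d + l))
    (fun j => @gact1 _ _ _ M (d + j)) shift_actM.
End Shift.

Definition shift_map M N (f : gmor M N) (d : int) : gmor (shift M d) (shift N d) :=
  @GMor k s A (shift M d) (shift N d) (fun j => f (d + j))
    (fun j => @gm_linear _ _ _ _ _ f (d + j))
    (fun j l => @gm_act _ _ _ _ _ f (d + j) (d + l)).

Definition giso M N : Prop := exists f : gmor M N, forall j, bijective (f j).

Definition gsurj M N (f : gmor M N) : Prop := forall j y, exists x, f j x = y.

Definition gtrivial (V : int -> lmodType k) : Prop := forall j (x : V j), x = 0.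

Record gsub M := GSub {
  gsub_piece :> forall j, subspace (M j);
  gsub_act : forall j l a x, gsub_piece j x -> gsub_piece l (gact M j l a x) }.

Section SubMod.
Variables (M : gmod s A) (S : gsub M).

Definition gsub_actf j l a (x : sub_of (S j)) : sub_of (S l) :=
  mksub (gsub_act l a (sub_valP x)).
Arguments gsub_actf : clear implicits.
Fact gsub_linear_l j l x : linear (fun a => gsub_actf j l a x).
Proof. by move=> c a b; apply: sub_val_inj; exact: gact_linear_l. Qed.
Fact gsub_linear_r j l a : linear (gsub_actf j l a).
Proof. by move=> c u v; apply: sub_val_inj; exact: gact_linear_r. Qed.
Fact gsub_act1 j x : gsub_actf j j 1 x = x.
Proof. by apply: sub_val_inj; exact: gact1. Qed.
Fact gsub_actM j l p a b x : gsub_actf l p a (gsub_actf j l b x) =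
  gsub_actf j p (smul s (zcomp (p - l) a) (zcomp (l - j) b)) x.
Proof. by apply: sub_val_inj; exact: gactM. Qed.
Definition gsubmod : gmod s A :=
  @GMod k s A (fun j => sub_of (S j)) gsub_actf
    gsub_linear_l gsub_linear_r gsub_act1 gsub_actM.

Definition gincl : gmor gsubmod M :=
  @GMor k s A gsubmod M (fun j => @sub_val k _ (S j)) (fun j c u v => erefl)
    (fun j l a x => erefl).

Fact gquo_ker j l a (x : M j) : S j x -> quo_pi (S l) (gact M j l a x) = 0.
Proof.
move=> Sx; rewrite -[RHS](lin0 (@quo_pi_linear k _ (S l))).
by apply/quo_piE; rewrite subr0; exact: gsub_act.
Qed.
Fact gquo_lin j l a : linear (fun x => quo_pi (S l) (gact M j l a x)).
Proof. by move=> c u v; rewrite gact_linear_r quo_pi_linear. Qed.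
Definition gquo_actf (j l : int) (a : A) : quo_of (S j) -> quo_of (S l) :=
  quo_lift (fun x => quo_pi (S l) (gact M j l a x)).
Arguments gquo_actf : clear implicits.
Lemma gquo_actE j l a x :
  gquo_actf j l a (quo_pi (S j) x) = quo_pi (S l) (gact M j l a x).
Proof. exact: quo_liftE (gquo_lin _ _) (@gquo_ker _ _ _) _. Qed.
Fact gquo_linear_l j l x : linear (fun a => gquo_actf j l a x).
Proof.
move=> c a b; rewrite -[x]quo_reprK !gquo_actE -quo_pi_linear.
by rewrite gact_linear_l.
Qed.
Fact gquo_linear_r j l a : linear (gquo_actf j l a).
Proof. exact: quo_lift_linear (gquo_lin _ _) (@gquo_ker _ _ _). Qed.
Fact gquo_act1 j x : gquo_actf j j 1 x = x.
Proof. by rewrite -[x]quo_reprK gquo_actE gact1. Qed.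
Fact gquo_actM j l p a b x : gquo_actf l p a (gquo_actf j l b x) =
  gquo_actf j p (smul s (zcomp (p - l) a) (zcomp (l - j) b)) x.
Proof. by rewrite -[x]quo_reprK !gquo_actE gactM. Qed.
Definition gquo : gmod s A :=
  @GMod k s A (fun j => quo_of (S j)) gquo_actf
    gquo_linear_l gquo_linear_r gquo_act1 gquo_actM.
End SubMod.

(* The projection M/S -> M/T for S contained in T. *)
Section QuoMap.
Variables (M : gmod s A) (S T : gsub M).
Hypothesis ST : forall j x, S j x -> T j x.

Fact gquo_proj_ker j x : S j x -> quo_pi (T j) x = 0.
Proof.
move=> Sx; rewrite -[RHS](lin0 (@quo_pi_linear k _ (T j))).
by apply/quo_piE; rewrite subr0; exact: ST.
Qed.
Definition gquo_projf j : quo_of (S j) -> quo_of (T j) := quo_lift (quo_pi (T j)).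
Lemma gquo_projE j x : gquo_projf (quo_pi (S j) x) = quo_pi (T j) x.
Proof. exact: quo_liftE (@quo_pi_linear _ _ _) (@gquo_proj_ker j) _. Qed.
Fact gquo_proj_linear j : linear (@gquo_projf j).
Proof. exact: quo_lift_linear (@quo_pi_linear _ _ _) (@gquo_proj_ker j). Qed.
Fact gquo_proj_act j l a x :
  gquo_projf (gact (gquo S) j l a x) = gact (gquo T) j l a (gquo_projf x).
Proof.
by rewrite -[x]quo_reprK /= gquo_actE !gquo_projE /= gquo_actE.
Qed.
Definition gquo_proj : gmor (gquo S) (gquo T) :=
  @GMor k s A (gquo S) (gquo T) gquo_projf gquo_proj_linear gquo_proj_act.
End QuoMap.

Section Kernel.
Variables (M N : gmod s A) (f : gmor M N).
Fact gker0 j : f j 0 = 0.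
Proof. exact: lin0 (@gm_linear _ _ _ _ _ f j). Qed.
Fact gkerP j c u v : f j u = 0 -> f j v = 0 -> f j (c *: u + v) = 0.
Proof. by rewrite gm_linear => -> ->; rewrite scaler0 addr0. Qed.
Fact gker_act j l a x : f j x = 0 -> f l (gact M j l a x) = 0.
Proof. by rewrite gm_act => ->; rewrite (lin0 (@gact_linear_r _ _ _ _ _ _ _)). Qed.
Definition gker : gsub M :=
  @GSub M (fun j => @Subspace k (M j) (fun x => f j x = 0) (gker0 j) (@gkerP j))
    gker_act.
End Kernel.

Definition gsimple M : Prop := (exists j (x : M j), x <> 0) /\
  forall S : gsub M, (forall j x, S j x -> x = 0) \/ (forall j x, S j x).

Definition concentrated0 M : Prop := forall j (x : M j), j <> 0 -> x = 0.

Definition gfingen M : Prop := exists (r : nat) (t : 'I_r -> {j : int & M j}),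
  forall S : gsub M, (forall i, S (tag (t i)) (tagged (t i))) ->
  forall j x, S j x.

(* Projectivity in the category of graded modules and degree-zero maps. *)
Definition gprojective P : Prop :=
  forall M N (f : gmor M N) (g : gmor P N), gsurj f ->
  exists h : gmor P M, forall j x, f j (h j x) = g j x.

Definition regact j l (a : A) (x : sub_of (homog_space A j)) : A :=
  smul s (zcomp (l - j) a) (sub_val x).
Fact regact_homog j l a x : homog_space A l (@regact j l a x).
Proof.
rewrite -[X in homog_space A X](subrK j).
exact: homog_smul (zcompK _ _) (sub_valP x).
Qed.
Definition reg_actf j l a x : sub_of (homog_space A l) :=
  mksub (@regact_homog j l a x).
Arguments reg_actf : clear implicits.
Fact reg_linear_l j l x : linear (fun a => reg_actf j l a x).
Proof.
move=> c a b; apply: sub_val_inj; rewrite /= /regact zcomp_linear.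
exact: smul_linear_l.
Qed.
Fact reg_linear_r j l a : linear (reg_actf j l a).
Proof. by move=> c u v; apply: sub_val_inj; exact: smul_linear_r. Qed.
Fact reg_act1 j x : reg_actf j j 1 x = x.
Proof. by apply: sub_val_inj; rewrite /= /regact subrr (homog1 A) smul1r. Qed.
Fact reg_actM j l p a b x : reg_actf l p a (reg_actf j l b x) =
  reg_actf j p (smul s (zcomp (p - l) a) (zcomp (l - j) b)) x.
Proof.
apply: sub_val_inj; rewrite /= /regact /= /regact smulA; congr smul.
apply/esym; have <- : (p - l) + (l - j) = p - j by rewrite addrA subrK.
by apply: homog_smul; exact: zcompK.
Qed.
Definition reg : gmod s A :=
  @GMod k s A (fun j => sub_of (homog_space A j)) reg_actf
    reg_linear_l reg_linear_r reg_act1 reg_actM.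

Section RegGe.
Variable d : nat.
Fact reg_ge0 (j : int) : (d%:Z <= j) \/ (0 : reg j) = 0.
Proof. by right. Qed.
Fact reg_geP (j : int) (c : k) (u v : reg j) :
  (d%:Z <= j) \/ u = 0 -> (d%:Z <= j) \/ v = 0 -> (d%:Z <= j) \/ c *: u + v = 0.
Proof. by move=> [|->]; [left|move=> [|->]; [left|right; rewrite scaler0 addr0]]. Qed.
Fact reg_ge_act j l a (x : reg j) :
  (d%:Z <= j) \/ x = 0 -> (d%:Z <= l) \/ gact reg j l a x = 0.
Proof.
move=> [dj|->]; last by right; rewrite (lin0 (@gact_linear_r _ _ _ _ _ _ _)).
have [jl|lj] := Order.TotalTheory.leP j l.
  by left; exact: Order.POrderTheory.le_trans jl.
right; rewrite -gactE; have : l - j < 0 by rewrite Num.Theory.subr_lt0.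
by case: (l - j) => // i _; rewrite (lin0 (@gact_linear_l _ _ _ _ _ _ _)).
Qed.
Definition reg_ge : gsub reg :=
  @GSub reg (fun j => @Subspace k (reg j) (fun x => (d%:Z <= j) \/ x = 0)
    (reg_ge0 j) (@reg_geP j)) reg_ge_act.

Definition reg_trunc : gmod s A := gquo reg_ge.
End RegGe.

Fact reg_ge_mono (i j : nat) : (i <= j)%N ->
  forall l x, reg_ge j l x -> reg_ge i l x.
Proof.
move=> ij l x [jl|->]; last by right.
by left; apply: Order.POrderTheory.le_trans jl.
Qed.

Definition trunc_proj (i j : nat) (ij : (i <= j)%N) :
  gmor (reg_trunc j) (reg_trunc i) := gquo_proj (reg_ge_mono ij).
End GradedModules.

Section Free.
Variables (k : fieldType) (s : side) (A : galg k) (T : choiceType) (deg : T -> int).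

(* The graded free module on generators [t : T] of degree [deg t]; its elements
   are the finitely supported families of coefficients. *)
Definition fsupp (u : T -> A) : set T := [set t | u t <> 0].

Definition free_pred (l : int) (u : T -> A) : Prop :=
  finite_set (fsupp u) /\ forall t, homog (l - deg t) (u t).

Fact free_pred0 l : free_pred l 0.
Proof.
split; last by move=> t; exact: homog0.
by apply: (sub_finite_set (B := set0)) => // t /=; case.
Qed.

Fact free_predP l (c : k) u v :
  free_pred l u -> free_pred l v -> free_pred l (c *: u + v).
Proof.
move=> [uF uH] [vF vH]; split; last by move=> t; exact: homogP.
apply: (sub_finite_set (B := fsupp u `|` fsupp v)); last first.
  by rewrite finite_setU.
move=> t /= uvt; have [u0|] := pselect (u t = 0); [right=> v0|by left].
by apply: uvt; rewrite -[LHS]/(c *: u t + v t) u0 v0 scaler0 addr0.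
Qed.

Definition free_space l : subspace (T -> A) :=
  @Subspace k (T -> A) (free_pred l) (free_pred0 l) (@free_predP l).

Fact free_actP j l a (u : sub_of (free_space j)) :
  free_space l (fun t => smul s (zcomp (l - j) a) (sub_val u t)).
Proof.
have [uF uH] := sub_valP u; split.
  apply: sub_finite_set uF => t /= ut u0; apply: ut; rewrite u0.
  exact: lin0 (@smul_linear_r _ _ _ _).
move=> t; have -> : l - deg t = (l - j) + (j - deg t) by rewrite addrA subrK.
by apply: homog_smul; [exact: zcompK | exact: uH].
Qed.
Definition free_actf j l a u : sub_of (free_space l) := mksub (@free_actP j l a u).
Arguments free_actf : clear implicits.

Fact free_linear_l j l x : linear (fun a => free_actf j l a x).
Proof.
move=> c a b; apply: sub_val_inj; apply/funext => t /=.
by rewrite zcomp_linear; exact: smul_linear_l.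
Qed.
Fact free_linear_r j l a : linear (free_actf j l a).
Proof.
move=> c u v; apply: sub_val_inj; apply/funext => t; exact: smul_linear_r.
Qed.
Fact free_act1 j x : free_actf j j 1 x = x.
Proof.
by apply: sub_val_inj; apply/funext => t /=; rewrite subrr (homog1 A) smul1r.
Qed.
Fact free_actM j l p a b x : free_actf l p a (free_actf j l b x) =
  free_actf j p (smul s (zcomp (p - l) a) (zcomp (l - j) b)) x.
Proof.
apply: sub_val_inj; apply/funext => t /=; rewrite smulA; congr smul.
apply/esym; have <- : (p - l) + (l - j) = p - j by rewrite addrA subrK.
by apply: homog_smul; exact: zcompK.
Qed.
Definition free : gmod s A :=
  @GMod k s A (fun l => sub_of (free_space l)) free_actf
    free_linear_l free_linear_r free_act1 free_actM.

Fact basis_subproof t : free_space (deg t) (fun t' => if t' == t then 1 else 0).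
Proof.
split; last first.
  by move=> t'; case: eqP => [->|_]; [rewrite subrr; exact: homog1|exact: homog0].
apply: (sub_finite_set (B := [set t])) => // t'.
by rewrite /fsupp /=; case: (t' =P t) => // _ [].
Qed.
Definition basis t : free (deg t) := mksub (basis_subproof t).

Section Lift.
Variables (N : gmod s A) (g : forall t, N (deg t)).

Definition free_liftf l (u : free l) : N l :=
  \sum_(t \in [set: T]) gact N (deg t) l (sub_val u t) (g t).

Lemma free_liftE l (u : free l) (r : seq T) : uniq r ->
  (forall t, sub_val u t <> 0 -> t \in r) ->
  free_liftf u = \sum_(t <- r) gact N (deg t) l (sub_val u t) (g t).
Proof.
move=> rU ur; rewrite fsbig_seq //; apply/esym/fsbig_widen => //.
move=> t [_ /= /negP tr]; have [->|/ur] := pselect (sub_val u t = 0).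
  exact: lin0 (@gact_linear_l _ _ _ _ _ _ _).
by rewrite (negbTE tr).
Qed.

Lemma free_support l (u : free l) :
  exists r : seq T, uniq r /\ forall t, sub_val u t <> 0 -> t \in r.
Proof.
have [/finite_seqP[r ru] _] := sub_valP u.
exists (undup r); split; first exact: undup_uniq.
move=> t ut; rewrite mem_undup; have := ut; rewrite -[X in X -> _]/(fsupp (sub_val u) t).
by rewrite ru.
Qed.

Fact free_lift_linear l : linear (@free_liftf l).
Proof.
move=> c u v; have [r [rU ur]] := free_support u.
have [q [qU vq]] := free_support v.
have w1 t : sub_val u t <> 0 -> t \in undup (r ++ q).
  by move=> /ur tr; rewrite mem_undup mem_cat tr.
have w2 t : sub_val v t <> 0 -> t \in undup (r ++ q).
  by move=> /vq tq; rewrite mem_undup mem_cat tq orbT.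
rewrite !(free_liftE (undup_uniq (r ++ q))) //; last first.
  move=> t uvt; have [u0|/w1//] := pselect (sub_val u t = 0).
  apply: w2 => v0; apply: uvt.
  by rewrite -[LHS]/(c *: sub_val u t + sub_val v t) u0 v0 scaler0 addr0.
rewrite scaler_sumr -big_split; apply: eq_bigr => t _ /=.
exact: gact_linear_l.
Qed.

Fact free_lift_act j l a x :
  @free_liftf l (gact free j l a x) = gact N j l a (free_liftf x).
Proof.
have [r [rU xr]] := free_support x.
rewrite !(free_liftE rU) //; last first.
  move=> t /= xt; apply: xr => x0; apply: xt; rewrite x0.
  exact: lin0 (@smul_linear_r _ _ _ _).
rewrite (lin_sum (@gact_linear_r _ _ _ _ _ _ _)); apply: eq_bigr => t _ /=.
by rewrite gactM; have [_ ->] := sub_valP x.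
Qed.

Definition free_lift : gmor free N :=
  @GMor k s A free N free_liftf free_lift_linear free_lift_act.

Lemma free_lift_basis t : free_lift (deg t) (basis t) = g t.
Proof.
rewrite /= (@free_liftE _ _ [:: t]) // => [|t' /=].
  by rewrite big_seq1 /= eqxx gact1.
by rewrite inE; case: (t' =P t).
Qed.
End Lift.

Lemma free_sum l (u : free l) (r : seq T) : uniq r ->
  (forall t, sub_val u t <> 0 -> t \in r) ->
  u = \sum_(t <- r) gact free (deg t) l (sub_val u t) (basis t).
Proof.
move=> rU ur; apply: sub_val_inj; rewrite (lin_sum (@sub_val_linear _ _ _)).
rewrite fct_sumE; apply/funext => t' /=.
have [_ uH] := sub_valP u.
have E t : smul s (zcomp (l - deg t) (sub_val u t)) (if t' == t then 1 else 0) =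
    if t' == t then sub_val u t else 0.
  rewrite uH; case: eqP => _; first exact: smulr1.
  exact: lin0 (@smul_linear_r _ _ _ _).
under eq_bigr do rewrite E.
rewrite -big_mkcond /=; have [tr|tr] := boolP (t' \in r).
  rewrite (eq_bigl (pred1 t')) => [|t]; last by rewrite /= eq_sym.
  by rewrite -big_filter filter_pred1_uniq // big_seq1.
rewrite big_seq_cond big1 => [|t /andP[tr' /eqP e]]; last by rewrite e tr' in tr.
by apply: contrapT => /ur; apply/negP.
Qed.

Lemma free_ext (N : gmod s A) (f f' : gmor free N) :
  (forall t, f (deg t) (basis t) = f' (deg t) (basis t)) -> f = f'.
Proof.
move=> ff; apply: gmor_ext => l u; have [r [rU ur]] := free_support u.
rewrite (free_sum rU ur) !(lin_sum (@gm_linear _ _ _ _ _ _ _)).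
by apply: eq_bigr => t _; rewrite !gm_act ff.
Qed.

Lemma free_projective : gprojective free.
Proof.
move=> M N f g fS.
pose h t := xget 0 [set x | f (deg t) x = g (deg t) (basis t)].
have hP t : f (deg t) (h t) = g (deg t) (basis t).
  exact: xgetPex (fS _ _).
exists (free_lift h) => j x.
suff -> : g = gcomp f (free_lift h) by [].
by apply: free_ext => t /=; rewrite -[free_liftf _ _]/(free_lift h _ _)
  free_lift_basis hP.
Qed.
End Free.

Record presolution (k : fieldType) (s : side) (A : galg k) (M : gmod s A) :=
  PResolution {
    pres :> nat -> gmod s A;
    pdiff : forall i, gmor (pres i.+1) (pres i);
    paug : gmor (pres 0%N) M;
    pres_projective : forall i, gprojective (pres i);
    paug_surj : gsurj paug;
    pexact0 : forall j x, paug j x = 0 <-> exists y, pdiff 0 j y = x;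
    pexact : forall i j x, pdiff i j x = 0 <-> exists y, pdiff i.+1 j y = x }.

Section StandardResolution.
Variables (k : fieldType) (s : side) (A : galg k).
Implicit Types M N P : gmod s A.

Definition gelt M : choiceType := {j : int & M j}.
Definition gelt_in M j (x : M j) : gelt M := @Tagged _ j (fun i => M i) x.

(* The free module on the homogeneous elements of [M]. *)
Definition cover M : gmod s A := @free k s A (gelt M) tag.
Definition basis_of M (t : gelt M) : cover M (tag t) :=
  @basis k s A (gelt M) tag t.
Definition cover_aug M : gmor (cover M) M :=
  @free_lift k s A (gelt M) tag M (fun t => tagged t).

Lemma cover_aug_basis M (t : gelt M) : cover_aug M (tag t) (basis_of t) = tagged t.
Proof. exact: (@free_lift_basis k s A (gelt M) tag). Qed.

Lemma cover_aug_surj M : gsurj (cover_aug M).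
Proof.
move=> j y; exists (basis_of (gelt_in y)).
exact: (cover_aug_basis (gelt_in y)).
Qed.

(* The [i]-th syzygy of [M] with respect to the canonical covers. *)
Fixpoint syz (i : nat) M : gmod s A :=
  if i is i'.+1 then gsubmod (gker (cover_aug (syz i' M))) else M.

Definition std_diff M i : gmor (cover (syz i.+1 M)) (cover (syz i M)) :=
  gcomp (gincl (gker (cover_aug (syz i M)))) (cover_aug (syz i.+1 M)).

Fact std_projective M i : gprojective (cover (syz i M)).
Proof. exact: free_projective. Qed.

Lemma std_diff_im M i j x :
  cover_aug (syz i M) j x = 0 <-> exists y, std_diff M i j y = x.
Proof.
split=> [x0|[y <-]]; last exact: (sub_valP (cover_aug (syz i.+1 M) j y)).
have [y yx] := @cover_aug_surj (syz i.+1 M) j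
  (@mksub _ _ (gker (cover_aug (syz i M)) j) x x0).
by exists y; rewrite /std_diff /gcomp -[LHS]/(sub_val (cover_aug (syz i.+1 M) j y)) yx.
Qed.

Fact std_exact M i j x :
  std_diff M i j x = 0 <-> exists y, std_diff M i.+1 j y = x.
Proof.
rewrite -std_diff_im; split=> [x0|x0]; last first.
  by rewrite /std_diff -[LHS]/(sub_val (cover_aug (syz i.+1 M) j x)) x0.
exact: sub_val_inj.
Qed.

(* Derived functors are computed with this strictly functorial resolution. *)
Definition std_res M : presolution M :=
  @PResolution k s A M (fun i => cover (syz i M)) (std_diff M) (cover_aug M)
    (@std_projective M) (@cover_aug_surj M) (@std_diff_im M 0) (@std_exact M).

Section Functoriality.
Variables (M N : gmod s A) (f : gmor M N).

Definition cover_map : gmor (cover M) (cover N) :=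
  @free_lift k s A (gelt M) tag (cover N)
    (fun t => basis_of (gelt_in (f _ (tagged t)))).

Lemma cover_map_basis (t : gelt M) : cover_map (tag t) (basis_of t) =
  basis_of (gelt_in (f _ (tagged t))).
Proof. exact: (@free_lift_basis k s A (gelt M) tag). Qed.

Lemma cover_map_aug : gcomp (cover_aug N) cover_map = gcomp f (cover_aug M).
Proof.
apply: free_ext => t; rewrite -[LHS]/(cover_aug N _ (cover_map _ (basis_of t))).
rewrite -[RHS]/(f _ (cover_aug M _ (basis_of t))) cover_map_basis.
by rewrite cover_aug_basis (cover_aug_basis (gelt_in _)).
Qed.

Lemma cover_map_augE j x : cover_aug N j (cover_map j x) = f j (cover_aug M j x).
Proof. exact: (congr1 (fun h : gmor _ _ => h j x) cover_map_aug). Qed.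

Fact omega_map_ker j (x : gsubmod (gker (cover_aug M)) j) :
  gker (cover_aug N) j (cover_map j (sub_val x)).
Proof. by rewrite /= -[LHS]/(cover_aug N j _) cover_map_augE (sub_valP x) gker0. Qed.

Definition omega_map :
    gmor (gsubmod (gker (cover_aug M))) (gsubmod (gker (cover_aug N))).
Proof.
refine (@GMor k s A (gsubmod (gker (cover_aug M))) (gsubmod (gker (cover_aug N)))
  (fun j x => mksub (@omega_map_ker j x)) _ _).
- by move=> j c u v; apply: sub_val_inj; exact: (@gm_linear _ _ _ _ _ cover_map).
- by move=> j l a x; apply: sub_val_inj; exact: (@gm_act _ _ _ _ _ cover_map).
Defined.
End Functoriality.

Lemma cover_map_id M : cover_map (gid M) = gid (cover M).
Proof.
apply: free_ext => t; rewrite -[LHS]/(cover_map (gid M) _ (basis_of t)).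
by rewrite cover_map_basis; case: t.
Qed.

Lemma cover_map_comp M N P (g : gmor N P) (f : gmor M N) :
  cover_map (gcomp g f) = gcomp (cover_map g) (cover_map f).
Proof.
apply: free_ext => t; rewrite -[LHS]/(cover_map (gcomp g f) _ (basis_of t)).
rewrite -[RHS]/(cover_map g _ (cover_map f _ (basis_of t))) !cover_map_basis.
by rewrite (cover_map_basis g (gelt_in _)).
Qed.

Fixpoint syz_map (i : nat) M N (f : gmor M N) : gmor (syz i M) (syz i N) :=
  if i is i'.+1 then omega_map (syz_map i' f) else f.

Lemma syz_map_id i M : syz_map i (gid M) = gid (syz i M).
Proof.
elim: i => //= i IH; rewrite IH; apply: gmor_ext => j x; apply: sub_val_inj.
by rewrite /= -[LHS]/(cover_map (gid _) j (sub_val x)) cover_map_id.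
Qed.

Lemma syz_map_comp i M N P (g : gmor N P) (f : gmor M N) :
  syz_map i (gcomp g f) = gcomp (syz_map i g) (syz_map i f).
Proof.
elim: i => //= i IH; rewrite IH; apply: gmor_ext => j x; apply: sub_val_inj.
by rewrite /= -[LHS]/(cover_map (gcomp _ _) j (sub_val x)) cover_map_comp.
Qed.

Definition std_map M N (f : gmor M N) (i : nat) :
  gmor (std_res M i) (std_res N i) := cover_map (syz_map i f).

Lemma std_map_id M i : std_map (gid M) i = gid (std_res M i).
Proof. by rewrite /std_map syz_map_id cover_map_id. Qed.

Lemma std_map_comp M N P (g : gmor N P) (f : gmor M N) i :
  std_map (gcomp g f) i = gcomp (std_map g i) (std_map f i).
Proof. by rewrite /std_map syz_map_comp cover_map_comp. Qed.

Lemma std_map_diff M N (f : gmor M N) i :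
  gcomp (std_map f i) (pdiff (std_res M) i) =
  gcomp (pdiff (std_res N) i) (std_map f i.+1).
Proof.
apply: gmor_ext => j x.
exact: esym (congr1 (@sub_val _ _ _) (cover_map_augE (syz_map i.+1 f) x)).
Qed.
End StandardResolution.

Section Ext.
Variables (k : fieldType) (s : side) (A : galg k).
Implicit Types M N : gmod s A.

Lemma gcomp_linear_l M N P (f : gmor M N) : linear (fun g : gmor N P => gcomp g f).
Proof. by move=> c g h; apply: gmor_ext => j x; rewrite /= !addr0 !scale1r. Qed.

Lemma gcomp_linear_r M N P (g : gmor N P) : linear (fun f : gmor M N => gcomp g f).
Proof.
move=> c f h; apply: gmor_ext => j x; rewrite /= !addr0 !scale1r.
exact: gm_linear.
Qed.

Lemma gcompA M N P Q (h : gmor P Q) (g : gmor N P) (f : gmor M N) :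
  gcomp h (gcomp g f) = gcomp (gcomp h g) f.
Proof. exact: gmor_ext. Qed.

Lemma gcomp_idr M N (f : gmor M N) : gcomp f (gid M) = f.
Proof. exact: gmor_ext. Qed.

Lemma gcomp_idl M N (f : gmor M N) : gcomp (gid N) f = f.
Proof. exact: gmor_ext. Qed.

Lemma gcomp0l M N P (f : gmor M N) : gcomp (0 : gmor N P) f = 0.
Proof. exact: lin0 (@gcomp_linear_l _ _ _ _). Qed.

Lemma gcomp0r M N P (g : gmor N P) : gcomp g (0 : gmor M N) = 0.
Proof. exact: lin0 (@gcomp_linear_r _ _ _ _). Qed.

Section ExtOf.
Variables (M : gmod s A) (P : presolution M) (N : gmod s A) (i : nat).

Fact cocycles0 : gcomp (0 : gmor (P i) N) (pdiff P i) = 0.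
Proof. exact: lin0 (@gcomp_linear_l _ _ _ _). Qed.
Fact cocyclesP (c : k) (u v : gmor (P i) N) :
  gcomp u (pdiff P i) = 0 -> gcomp v (pdiff P i) = 0 ->
  gcomp (c *: u + v) (pdiff P i) = 0.
Proof.
move=> u0 v0; have -> := @gcomp_linear_l _ _ N (pdiff P i) c u v.
by rewrite u0 v0 scaler0 addr0.
Qed.
Definition cocycles : subspace (gmor (P i) N) :=
  @Subspace k (gmor (P i) N) (fun c => gcomp c (pdiff P i) = 0) cocycles0 cocyclesP.

Definition is_coboundary : gmor (P i) N -> Prop :=
  match i return gmor (P i) N -> Prop with
  | 0%N => fun c => c = 0
  | i'.+1 => fun c => exists b : gmor (P i') N, gcomp b (pdiff P i') = c
  end.

Fact is_coboundary0 : is_coboundary 0.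
Proof.
rewrite /is_coboundary; case: i => // i'.
by exists 0; exact: lin0 (@gcomp_linear_l _ _ _ _).
Qed.
Fact is_coboundaryP (c : k) u v :
  is_coboundary u -> is_coboundary v -> is_coboundary (c *: u + v).
Proof.
rewrite /is_coboundary; case: i u v => [|i'] u v.
  by move=> -> ->; rewrite scaler0 addr0.
by move=> [a <-] [b <-]; exists (c *: a + b); exact: gcomp_linear_l.
Qed.
Definition coboundaries : subspace (sub_of cocycles) :=
  @Subspace k (sub_of cocycles) (fun c => is_coboundary (sub_val c))
    is_coboundary0 (fun c u v => @is_coboundaryP c (sub_val u) (sub_val v)).

(* The cohomology in degree [i] of the complex Hom(P, N)_0. *)
Definition ext_of : lmodType k := quo_of coboundaries.
End ExtOf.

(* The value at [N] of the [i]-th derived functor of Hom(M, -)_0. *)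
Definition Ext0 (i : nat) M N : lmodType k := ext_of (std_res M) N i.

Section ExtMap.
Variables (i : nat) (M M' N N' : gmod s A) (f : gmor M M') (g : gmor N N').

Fact ext_cochain_subproof (c : sub_of (cocycles (std_res M') N i)) :
  cocycles (std_res M) N' i (gcomp g (gcomp (sub_val c) (std_map f i))).
Proof.
have c0 : gcomp (sub_val c) (pdiff (std_res M') i) = 0 := sub_valP c.
change (gcomp (gcomp g (gcomp (sub_val c) (std_map f i)))
  (pdiff (std_res M) i) = 0).
rewrite -!gcompA std_map_diff [X in gcomp _ X]gcompA c0.
by rewrite gcomp0l gcomp0r.
Qed.
Definition ext_cochain c : sub_of (cocycles (std_res M) N' i) :=
  mksub (@ext_cochain_subproof c).

Fact ext_cochain_linear : linear ext_cochain.
Proof.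
move=> c u v; apply: sub_val_inj; apply: gmor_ext => j x.
rewrite /= !addr0 !scale1r; exact: gm_linear.
Qed.

Fact ext_cochain_coboundary c : coboundaries (std_res M') N i c ->
  quo_pi (coboundaries (std_res M) N' i) (ext_cochain c) = 0.
Proof.
move=> cB; rewrite -[RHS](lin0 (@quo_pi_linear k _ (coboundaries (std_res M) N' i))).
apply/quo_piE; rewrite subr0.
rewrite /= in cB *; move: (sub_val c) cB; rewrite /is_coboundary.
case: (i) => [|i'] b.
  by move=> ->; rewrite gcomp0l gcomp0r.
move=> [a <-]; exists (gcomp g (gcomp a (std_map f i'))).
by rewrite -!gcompA std_map_diff -!gcompA.
Qed.

Fact ext_cochain_pi_linear :
  linear (quo_pi (coboundaries (std_res M) N' i) \o ext_cochain).
Proof. by move=> c u v; rewrite /= ext_cochain_linear quo_pi_linear. Qed.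

(* Functoriality of Ext in both variables: composition with [g] and with the
   chain map lifting [f]. *)
Definition Ext0_map : Ext0 i M' N -> Ext0 i M N' :=
  quo_lift (quo_pi (coboundaries (std_res M) N' i) \o ext_cochain).

Lemma Ext0_mapE c : Ext0_map (quo_pi _ c) = quo_pi _ (ext_cochain c).
Proof. exact: quo_liftE ext_cochain_pi_linear ext_cochain_coboundary _. Qed.

Lemma Ext0_map_linear : linear Ext0_map.
Proof. exact: quo_lift_linear ext_cochain_pi_linear ext_cochain_coboundary. Qed.
End ExtMap.
Arguments Ext0_map i {M M' N N'} f g x.

Lemma Ext0_map_id i M N x : Ext0_map i (gid M) (gid N) x = x.
Proof.
rewrite -[x]quo_reprK Ext0_mapE; congr quo_pi; apply: sub_val_inj.
by rewrite -[LHS]/(gcomp _ _) std_map_id gcomp_idr gcomp_idl.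
Qed.

Lemma Ext0_map_comp i M M' M'' N N' N'' (f : gmor M M') (f' : gmor M' M'')
    (g : gmor N N') (g' : gmor N' N'') x :
  Ext0_map i (gcomp f' f) (gcomp g' g) x = Ext0_map i f g' (Ext0_map i f' g x).
Proof.
rewrite -[x]quo_reprK !Ext0_mapE; congr quo_pi; apply: sub_val_inj.
rewrite -[LHS]/(gcomp (gcomp g' g) (gcomp _ (std_map (gcomp f' f) i))).
by rewrite std_map_comp -[RHS]/(gcomp g' (gcomp (gcomp g (gcomp _ _)) _)) !gcompA.
Qed.

Lemma Ext0_map_add i M M' N N' (f : gmor M M') c (g g' : gmor N N') x :
  Ext0_map i f (c *: g + g') x = c *: Ext0_map i f g x + Ext0_map i f g' x.
Proof.
rewrite -[x]quo_reprK !Ext0_mapE -quo_pi_linear; congr quo_pi.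
apply: sub_val_inj; apply: gmor_ext => j y.
by rewrite /= !addr0 !scale1r.
Qed.

(* Ext^i(M, N), with component Ext^i(M, N[d])_0 in degree d. *)
Definition Ext (i : nat) M N : int -> lmodType k := fun d => Ext0 i M (shift N d).

Definition Ext_map (i : nat) M M' N (f : gmor M M') d : Ext i M' N d -> Ext i M N d :=
  Ext0_map i f (gid (shift N d)).

Record kfunctor := KFunctor {
  kobj :> gmod s A -> lmodType k;
  kmap : forall M N, gmor M N -> kobj M -> kobj N;
  kmap_linear : forall M N (f : gmor M N), linear (kmap f);
  kmap_id : forall M x, kmap (gid M) x = x;
  kmap_comp : forall M N P (g : gmor N P) (f : gmor M N) x,
    kmap (gcomp g f) x = kmap g (kmap f x);
  kmap_add : forall M N c (f g : gmor M N) x,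
    kmap (c *: f + g) x = c *: kmap f x + kmap g x }.
Arguments kmap F {M N} f x : rename.

Fact Ext0_comp2 i M N P Q (g : gmor P Q) (f : gmor N P) x :
  Ext0_map i (gid M) (gcomp g f) x = Ext0_map i (gid M) g (Ext0_map i (gid M) f x).
Proof. by rewrite -Ext0_map_comp gcomp_idl. Qed.

Definition Ext_functor i M : kfunctor :=
  @KFunctor (Ext0 i M) (fun N N' g => Ext0_map i (gid M) g)
    (fun N N' g => @Ext0_map_linear i M M N N' (gid M) g)
    (@Ext0_map_id i M) (@Ext0_comp2 i M) (fun N N' => @Ext0_map_add i M M N N' (gid M)).

Lemma trunc_proj_id i (ii : (i <= i)%N) : trunc_proj s A ii = gid _.
Proof.
by apply: gmor_ext => j x; rewrite -[x]quo_reprK; exact: gquo_projE.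
Qed.

Lemma trunc_proj_comp i j l (ij : (i <= j)%N) (jl : (j <= l)%N) (il : (i <= l)%N) :
  gcomp (trunc_proj s A ij) (trunc_proj s A jl) = trunc_proj s A il.
Proof.
apply: gmor_ext => d x; rewrite -[x]quo_reprK.
rewrite /= (gquo_projE (@reg_ge_mono _ s A _ _ jl)).
rewrite (gquo_projE (@reg_ge_mono _ s A _ _ ij)).
by rewrite (gquo_projE (@reg_ge_mono _ s A _ _ il)).
Qed.

Section LocalCohomology.
Variable i : nat.

Definition gamma_tr N p q (pq : (p <= q)%N) :
    Ext0 i (reg_trunc s A p) N -> Ext0 i (reg_trunc s A q) N :=
  Ext0_map i (trunc_proj s A pq) (gid N).

Arguments gamma_tr N {p q} pq x.
Fact gamma_tr_linear N p q (pq : (p <= q)%N) : linear (gamma_tr N pq).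
Proof. exact: Ext0_map_linear. Qed.
Fact gamma_tr_id N p (pp : (p <= p)%N) x : gamma_tr N pp x = x.
Proof. by rewrite /gamma_tr trunc_proj_id Ext0_map_id. Qed.
Fact gamma_tr_comp N p q r (pq : (p <= q)%N) (qr : (q <= r)%N) (pr : (p <= r)%N) x :
  gamma_tr N qr (gamma_tr N pq x) = gamma_tr N pr x.
Proof. by rewrite /gamma_tr -Ext0_map_comp trunc_proj_comp gcomp_idl. Qed.

Definition gamma_sys N : dsystem k :=
  @DSystem k (fun p => Ext0 i (reg_trunc s A p) N) (fun p q pq => gamma_tr N pq)
    (@gamma_tr_linear N) (@gamma_tr_id N) (@gamma_tr_comp N).

(* The component of degree zero of [Gamma i N] below. *)
Definition Gamma0 N : lmodType k := dlim (gamma_sys N).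

Definition Gamma0_map N N' (g : gmor N N') : Gamma0 N -> Gamma0 N' :=
  @dl_map k (gamma_sys N) (gamma_sys N')
    (fun p => Ext0_map i (gid (reg_trunc s A p)) g).

Fact gamma_nat N N' (g : gmor N N') p q (pq : (p <= q)%N) x :
  Ext0_map i (gid (reg_trunc s A q)) g (gamma_tr N pq x) =
  gamma_tr N' pq (Ext0_map i (gid (reg_trunc s A p)) g x).
Proof. by rewrite /gamma_tr -!Ext0_map_comp !gcomp_idl !gcomp_idr. Qed.

Lemma Gamma0_mapE N N' (g : gmor N N') p (x : Ext0 i (reg_trunc s A p) N) :
  Gamma0_map g (@dl_in k (gamma_sys N) p x) =
  @dl_in k (gamma_sys N') p (Ext0_map i (gid (reg_trunc s A p)) g x).
Proof. exact: (@dl_mapE k (gamma_sys N) (gamma_sys N') _ (gamma_nat g)). Qed.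

Fact Gamma0_map_linear N N' (g : gmor N N') : linear (Gamma0_map g).
Proof.
apply: (@dl_map_linear k (gamma_sys N) (gamma_sys N')) => [p|].
  exact: Ext0_map_linear.
exact: gamma_nat.
Qed.
Fact Gamma0_map_id N x : Gamma0_map (gid N) x = x.
Proof. by have [p [u ->]] := dl_inP x; rewrite Gamma0_mapE Ext0_map_id. Qed.
Fact Gamma0_map_comp M N P (g : gmor N P) (f : gmor M N) x :
  Gamma0_map (gcomp g f) x = Gamma0_map g (Gamma0_map f x).
Proof. by have [p [u ->]] := dl_inP x; rewrite !Gamma0_mapE Ext0_comp2. Qed.
Fact Gamma0_map_add M N c (f g : gmor M N) x :
  Gamma0_map (c *: f + g) x = c *: Gamma0_map f x + Gamma0_map g x.
Proof.
have [p [u ->]] := dl_inP x; rewrite !Gamma0_mapE Ext0_map_add.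
exact: (@dl_in_linear k (gamma_sys N)).
Qed.

Definition Gamma_functor : kfunctor :=
  @KFunctor Gamma0 Gamma0_map Gamma0_map_linear Gamma0_map_id
    Gamma0_map_comp Gamma0_map_add.

Definition Gamma M : int -> lmodType k := fun d => Gamma0 (shift M d).
Definition Gamma_map M N (f : gmor M N) d : Gamma M d -> Gamma N d :=
  Gamma0_map (shift_map f d).

Lemma Gamma_map_linear M N (f : gmor M N) d : linear (@Gamma_map M N f d).
Proof. exact: Gamma0_map_linear. Qed.
End LocalCohomology.

Section RightMul.
Variables (a : A) (j l : int).
Local Notation R := (reg s A).

Fact rmul_homog p (x : shift R j p) :
  homog_space A (l + p) (smul s (sub_val x) (zcomp (l - j) a)).
Proof.
have -> : l + p = (j + p) + (l - j).
  by rewrite addrACA [p + _]addrC addrACA subrr add0r addrC.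
by apply: homog_smul; [exact: (sub_valP x) | exact: zcompK].
Qed.

(* Multiplication by the component of degree [l - j] of [a] on the side opposite
   to the module structure, as a degree-zero map from R[j] to R[l]. *)
Definition rmul : gmor (shift R j) (shift R l).
Proof.
refine (@GMor k s A (shift R j) (shift R l) (fun p x => mksub (@rmul_homog p x)) _ _).
- by move=> p c u v; apply: sub_val_inj; exact: smul_linear_l.
move=> p q b x; apply: sub_val_inj.
by rewrite /= /regact /= /regact !shift_deg smulA.
Defined.
End RightMul.

Section AtReg.
Variable F : kfunctor.
Local Notation R := (reg s A).

Definition at_reg_act j l (a : A) : F (shift R j) -> F (shift R l) := kmap F (rmul a j l).
Arguments at_reg_act : clear implicits.

Fact at_reg_linear_l j l x : linear (fun a => at_reg_act j l a x).
Proof.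
move=> c a b; rewrite /at_reg_act -kmap_add; congr kmap.
apply: gmor_ext => p y; apply: sub_val_inj.
by rewrite /= addr0 scale1r zcomp_linear; exact: smul_linear_r.
Qed.
Fact at_reg_linear_r j l a : linear (at_reg_act j l a).
Proof. exact: kmap_linear. Qed.
Fact at_reg_act1 j x : at_reg_act j j 1 x = x.
Proof.
rewrite -[RHS]kmap_id; congr kmap; apply: gmor_ext => p y; apply: sub_val_inj.
by rewrite /= subrr (homog1 A) smulr1.
Qed.
Fact at_reg_actM j l p a b x : at_reg_act l p a (at_reg_act j l b x) =
  at_reg_act j p (smul (opp_side s) (zcomp (p - l) a) (zcomp (l - j) b)) x.
Proof.
rewrite /at_reg_act -kmap_comp; congr kmap; apply: gmor_ext => q y.
apply: sub_val_inj; rewrite /= -smulA smul_opp; congr smul; apply/esym.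
have <- : (l - j) + (p - l) = p - j by rewrite addrC addrA subrK.
by apply: homog_smul; exact: zcompK.
Qed.

(* The graded module F(R), with component F(R[j]) in degree j; multiplication on
   the other side of the regular bimodule makes it a module on the other side. *)
Definition at_reg : gmod (opp_side s) A :=
  @GMod k (opp_side s) A (fun j => F (shift R j)) at_reg_act
    at_reg_linear_l at_reg_linear_r at_reg_act1 at_reg_actM.
End AtReg.
End Ext.

Definition gdual (k : fieldType) (V : int -> lmodType k) : int -> lmodType k :=
  fun j => dual (V (- j)).

Definition gdual_map (k : fieldType) (V W : int -> lmodType k)
    (f : forall j, V j -> W j) (fL : forall j, linear (f j)) j :
  gdual W j -> gdual V j := dual_map (fL (- j)).

Section DualModule.
Variables (k : fieldType) (s : side) (A : galg k) (M : gmod s A).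

Definition gdual_act j l (a : A) : gdual M j -> gdual M l :=
  dual_map (@gact_linear_r _ _ _ M (- l) (- j) a).
Arguments gdual_act : clear implicits.

Fact gdual_linear_l j l x : linear (fun a => gdual_act j l a x).
Proof.
move=> c a b; apply: sub_val_inj; apply/funext => y /=.
by rewrite gact_linear_l (sub_valP x).
Qed.
Fact gdual_linear_r j l a : linear (gdual_act j l a).
Proof. by move=> c u v; apply: sub_val_inj. Qed.
Fact gdual_act1 j x : gdual_act j j 1 x = x.
Proof. by apply: sub_val_inj; apply/funext => y /=; rewrite gact1. Qed.
Fact gdual_actM j l p a b x : gdual_act l p a (gdual_act j l b x) =
  gdual_act j p (smul (opp_side s) (zcomp (p - l) a) (zcomp (l - j) b)) x.
Proof.
apply: sub_val_inj; apply/funext => y /=; rewrite gactM smul_opp.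
by rewrite ![- _ - - _]addrC !opprK.
Qed.

Definition gdual_mod : gmod (opp_side s) A :=
  @GMod k (opp_side s) A (gdual M) gdual_act
    gdual_linear_l gdual_linear_r gdual_act1 gdual_actM.
End DualModule.

Section Gorenstein.
Variables (k : fieldType).

(* [Ext_reg i M] is Ext^i(M, A) with the module structure induced by the
   bimodule A. *)
Definition Ext_reg (s : side) (A : galg k) (i : nat) (M : gmod s A) :
  gmod (opp_side s) A := at_reg (Ext_functor i M).

Definition AS_Gorenstein (A : galg k) (n : nat) : Prop :=
  forall S : gmod Lft A, gsimple S -> concentrated0 S ->
  [/\ forall j : nat, j <> n -> gtrivial (Ext_reg j S),
      exists (n_S : int) (S' : gmod Rgt A),
        [/\ gsimple S', concentrated0 S' & giso (Ext_reg n S) (shift S' (- n_S))],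
      forall j : nat, j <> n -> gtrivial (Ext_reg j (Ext_reg n S))
    & giso (Ext_reg n (Ext_reg n S)) S].

Definition fg_resolution (s : side) (A : galg k) (M : gmod s A) : Prop :=
  exists P : presolution M, forall i, gfingen (P i).

Definition finite_left_lcd (A : galg k) : Prop :=
  exists l0 : nat, forall (M : gmod Lft A) (l : nat), (l0 < l)%N ->
    gtrivial (Gamma l M).

(* The left module D(Gamma^n(A)); its structure comes from the right structure
   of Gamma^n(A). *)
Definition D_Gamma (A : galg k) (n : nat) : gmod Lft A :=
  gdual_mod (at_reg (@Gamma_functor k Lft A n)).
End Gorenstein.

(* Main.v *)
Require Import Defs.
From mathcomp Require Import all_boot all_order all_algebra.
From mathcomp Require Import mathcomp_extra boolp classical_sets functions.
From mathcomp Require Import cardinality fsbigop.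
Import GRing.Theory.
Local Open Scope ring_scope.

Set Implicit Arguments.
Unset Strict Implicit.
Unset Printing Implicit Defensive.

(** Fix a degree [j] and write T^i(M) for the part of Gamma^i(M) in degree [- j].

    The truncations A/A_{>=p} are finite iterated extensions of shifted simple
    modules, because the degree-zero part of A is split. By the horseshoe lemma they
    inherit two properties of the simple modules: a resolution by finitely
    generated projectives, and the vanishing of Ext^i(-, A) for i <> n
    ([fg_ext_concentrated_trunc]). The first makes T^i commute with direct sums
    ([free_class_support]); together with the second, T^i vanishes on free modules
    for i <> n ([gamma_cover_vanish]).

    Finite local cohomology dimension and dimension shifting then give T^i = 0 for
    i > n ([gamma_above_vanish]). So T^n is right exact and commutes with direct
    sums, and a form on T^n(M) is the same thing as a map from M to the shifted
    module D(Gamma^n(A)): the form u corresponds to m |-> (x |-> u (x m)). This is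
    clear for free M, and follows in general from a presentation ([eval_inj],
    [eval_surj]).

    Since T^i also vanishes on free modules for i < n, the functors T^{n-m} are the
    left derived functors of T^n. Concretely, for n = m + i the m-fold connecting
    map embeds T^i(M) into T^n of the m-th syzygy, with image the classes that die
    in the preceding free cover ([iconnects_eq0r], [iconnects_image]). Dually, the
    forms on T^i(M) are the forms on T^n of the syzygy modulo those that come from
    the cover. On the other side, Ext^m(M, -) consists of the maps on the m-th
    syzygy modulo those that extend to the cover ([syz_class_surj],
    [syz_class_eq0]). Evaluation matches the two descriptions; [duality] is the graph
    of the resulting isomorphism. *)

(** * Extension of linear forms *)

Section LinearForms.
Variables (k : fieldType) (X Y : lmodType k).

Definition linear_rel (R : X -> Y -> Prop) : Prop :=
  forall (c : k) x x' y y', R x y -> R x' y' -> R (c *: x + x') (c *: y + y').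
End LinearForms.

Section LinearFormExtension.
Variables (k : fieldType) (Y : lmodType k).
Local Open Scope classical_set_scope.

(** Partial linear forms are handled through their graphs, so that the union of a
    chain of them needs no gluing. *)
Let form_graph (G : set (Y * k)) : Prop :=
  @linear_rel k Y k^o (fun y a => G (y, a)) /\ forall a, G (0, a) -> a = 0.

Let total_graph_form (G : set (Y * k)) : form_graph G ->
  (forall y, exists a, G (y, a)) ->
  exists w : dual Y, forall y a, G (y, a) -> sub_val w y = a.
Proof.
move=> [GL G0] /choice[w wG].
have wE y a : G (y, a) -> w y = a.
  move=> Gya; apply/eqP; rewrite -subr_eq0; apply/eqP/G0.
  have := GL (-1) _ _ _ _ Gya (wG y).
  by rewrite !scaleN1r addNr addrC.
have wL : linear_forms Y w.
  by move=> c u v; apply: wE; exact: GL.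
by exists (mksub wL).
Qed.

Let extend_graph (G : set (Y * k)) y0 : form_graph G -> (forall a, ~ G (y0, a)) ->
  form_graph [set p | exists c q, G q /\ p = (c *: y0 + q.1, q.2)].
Proof.
move=> [GL G0] y0G; split=> [c x x' y y'|a].
  move=> [d [q [Gq [-> ->]]]] [d' [q' [Gq' [-> ->]]]].
  exists (c * d + d'), (c *: q.1 + q'.1, c * q.2 + q'.2); split.
    by apply: (GL c); rewrite -surjective_pairing.
  by rewrite /= scalerDr scalerA scalerDl addrACA.
move=> [c [[y b] /= [Gq [e ->]]]].
have [c0|c0] := eqVneq c 0.
  by apply: G0; rewrite e c0 scale0r add0r.
have G00 : G (0, 0).
  by have := GL (-1) _ _ _ _ Gq Gq; rewrite !scaleN1r !addNr.
case: (y0G (- c^-1 * b)); have := GL (- c^-1) _ _ _ _ Gq G00.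
rewrite !addr0; congr (G (_, _)).
have -> : y = - (c *: y0) by apply/eqP; rewrite -addr_eq0 addrC -e.
by rewrite scalerN scaleNr opprK scalerA mulVf // scale1r.
Qed.

(** Zorn's lemma, applied to the graphs of partial forms that contain the one
    prescribed by [R]. The form is transported along a relation because the
    connecting maps below are only given by their graphs; a graph read backwards,
    or the graph of a surjection or of an inclusion, is equally good. *)
Lemma dual_extension (X : lmodType k) (R : X -> Y -> Prop) (u : dual X) :
  linear_rel R -> R 0 0 -> (forall x, R x 0 -> sub_val u x = 0) ->
  exists w : dual Y, forall x y, R x y -> sub_val u x = sub_val w y.
Proof.
move=> RL R00 Ru; pose G0 := [set p : Y * k | exists x, R x p.1 /\ p.2 = sub_val u x].
have uL := sub_valP u.
have G0P : form_graph G0.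
  split=> [c y y' a a' [x /= [Rx ->]] [x' /= [Rx' ->]]|a [x /= [Rx ->]]]; last exact: Ru.
  by exists (c *: x + x'); split; [exact: RL|rewrite /= uL].
have [] := @Zorn_bigcup (Y * k)%type [set G | form_graph (G0 `|` G)].
  move=> F FP Ftot; have U p q : (G0 `|` \bigcup_(G in F) G) p ->
      (G0 `|` \bigcup_(G in F) G) q -> exists H, [/\ form_graph H, H p, H q
      & H `<=` G0 `|` \bigcup_(G in F) G].
    have sub G : F G -> G0 `|` G `<=` G0 `|` \bigcup_(G in F) G.
      by move=> FG r [?|?]; [left|right; exists G].
    move=> [Gp|[G FG Gp]] [Gq|[H FH Hq]].
    - by exists G0; split=> // ?; left.
    - by exists (G0 `|` H); split; [exact: FP|left|right|exact: sub].
    - by exists (G0 `|` G); split; [exact: FP|right|left|exact: sub].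
    - have [GH|HG] := Ftot _ _ FG FH.
        by exists (G0 `|` H); split; [exact: FP|right; exact: GH|right|exact: sub].
      by exists (G0 `|` G); split; [exact: FP|right|right; exact: HG|exact: sub].
  split=> [c x x' y y' px py|a pa].
    by have [H [[HL _] Hp Hq]] := U _ _ px py; apply; exact: HL.
  by have [H [[_ H0] Ha _ _]] := U _ _ pa pa; exact: H0.
move=> G [GP Gmax].
have Gtot y : exists a, (G0 `|` G) (y, a).
  apply: contrapT => /forallNP yG.
  have GP' := extend_graph GP yG; set H := (X in form_graph X) in GP'.
  have GH : G0 `|` G `<=` H.
    by move=> p Gp; exists 0, p; rewrite scale0r add0r -surjective_pairing.
  apply: (Gmax H); last first.
    rewrite /= (_ : G0 `|` H = H) //; apply/seteqP; split=> p; last by right.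
    by move=> [?|//]; apply: GH; left.
  split; first by move=> p Gp; apply: GH; right.
  move=> HG; apply: (yG 0); right; apply: HG; exists 1, (0, 0); split.
    by left; exists 0; rewrite (lin0 uL).
  by rewrite /= scale1r addr0.
have [w wE] := total_graph_form GP Gtot.
by exists w => x y Rxy; rewrite (wE y (sub_val u x)) //; left; exists x.
Qed.
End LinearFormExtension.

(** * Homomorphisms of graded modules *)

Section Morphisms.
Variables (k : fieldType) (s : side) (A : galg k).
Implicit Types M N P : gmod s A.

Lemma gcompBl M N P (g g' : gmor N P) (f : gmor M N) :
  gcomp (g - g') f = gcomp g f - gcomp g' f.
Proof. exact: (linB (@gcomp_linear_l k s A M N P f)). Qed.

Lemma gcompBr M N P (g : gmor N P) (f f' : gmor M N) :
  gcomp g (f - f') = gcomp g f - gcomp g f'.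
Proof. exact: (linB (@gcomp_linear_r k s A M N P g)). Qed.

Lemma gcompDr M N P (g : gmor N P) (f f' : gmor M N) :
  gcomp g (f + f') = gcomp g f + gcomp g f'.
Proof. exact: (linD (@gcomp_linear_r k s A M N P g)). Qed.

Lemma gcompNl M N P (g : gmor N P) (f : gmor M N) : gcomp (- g) f = - gcomp g f.
Proof. exact: (linN (@gcomp_linear_l k s A M N P f)). Qed.

Lemma gcompNr M N P (g : gmor N P) (f : gmor M N) : gcomp g (- f) = - gcomp g f.
Proof. exact: (linN (@gcomp_linear_r k s A M N P g)). Qed.

Lemma gcompE M N P (g : gmor N P) (f : gmor M N) j x : gcomp g f j x = g j (f j x).
Proof. by []. Qed.

Lemma gmorDE M N (f g : gmor M N) j x : (f + g) j x = f j x + g j x.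
Proof. by rewrite /= !scale1r. Qed.

Lemma gmorNE M N (f : gmor M N) j x : (- f) j x = - f j x.
Proof. by rewrite /= addr0 scaleN1r. Qed.

Lemma gmorBE M N (f g : gmor M N) j x : (f - g) j x = f j x - g j x.
Proof. by rewrite gmorDE gmorNE. Qed.

Lemma gmorB M N (f : gmor M N) j x y : f j (x - y) = f j x - f j y.
Proof. exact: linB (@gm_linear _ _ _ _ _ f j) _ _. Qed.

Lemma gmorD M N (f : gmor M N) j x y : f j (x + y) = f j x + f j y.
Proof. exact: linD (@gm_linear _ _ _ _ _ f j) _ _. Qed.

Lemma gmor0 M N (f : gmor M N) j : f j 0 = 0.
Proof. exact: lin0 (@gm_linear _ _ _ _ _ f j). Qed.

Lemma gmorN M N (f : gmor M N) j x : f j (- x) = - f j x.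
Proof. exact: linN (@gm_linear _ _ _ _ _ f j) _. Qed.

Lemma gact0 M j l a : gact M j l a 0 = 0.
Proof. exact: lin0 (@gact_linear_r _ _ _ M j l a). Qed.

Lemma gcomp_app M N P (g : gmor N P) (f : gmor M N) (h : gmor M P) :
  gcomp g f = h -> forall j x, g j (f j x) = h j x.
Proof. by move=> <-. Qed.

Section Corestriction.
Variables (M N : gmod s A) (f : gmor M N) (S : gsub N).
Hypothesis fS : forall j x, S j (f j x).

Fact corestr_linear j : linear (fun x : M j => mksub (fS x) : gsubmod S j).
Proof. by move=> c u v; apply: sub_val_inj; exact: gm_linear. Qed.
Fact corestr_act j l a x :
  mksub (fS (gact M j l a x)) = gact (gsubmod S) j l a (mksub (fS x)).
Proof. by apply: sub_val_inj; exact: gm_act. Qed.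
Definition corestr : gmor M (gsubmod S) := GMor corestr_linear corestr_act.
End Corestriction.

Section Image.
Variables (M N : gmod s A) (f : gmor M N).

Fact gimg0 j : exists x, f j x = 0.
Proof. by exists 0; exact: gmor0. Qed.
Fact gimgP j c u v : (exists x, f j x = u) -> (exists x, f j x = v) ->
  exists x, f j x = c *: u + v.
Proof. by move=> [x <-] [y <-]; exists (c *: x + y); exact: gm_linear. Qed.
Fact gimg_act j l a u : (exists x, f j x = u) -> exists x, f l x = gact N j l a u.
Proof. by move=> [x <-]; exists (gact M j l a x); exact: gm_act. Qed.
Definition gimg : gsub N :=
  @GSub _ _ _ N (fun j => @Subspace k (N j) _ (gimg0 j) (@gimgP j)) gimg_act.
End Image.

Lemma gincl_inj M (S : gsub M) j : injective (gincl S j).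
Proof. exact: sub_val_inj. Qed.

(** Projectivity is tested against the surjection of [M] onto the image of [f]. *)
Lemma gprojective_lift P M N (f : gmor M N) (g : gmor P N) : gprojective P ->
  (forall j x, exists y, f j y = g j x) -> exists h, gcomp f h = g.
Proof.
move=> Pp fg.
have fI j x : gimg f j (f j x) by exists x.
have [|h hP] := Pp _ _ (corestr fI) (@corestr _ _ g (gimg f) fg).
  by move=> j [y /[dup] /subspace_predP[x <-] yP]; exists x; apply: sub_val_inj.
by exists h; apply: gmor_ext => j x; exact: (congr1 (@sub_val _ _ _) (hP j x)).
Qed.

Lemma gsurj_factor M N P (f : gmor M N) (g : gmor M P) : gsurj f ->
  (forall j x, f j x = 0 -> g j x = 0) -> exists h, gcomp h f = g.
Proof.
move=> fS fg; pose r j (y : N j) := sval (cid (fS j y)).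
have rK j y : f j (r j y) = y by exact: svalP (cid (fS j y)).
have rE j x : g j (r j (f j x)) = g j x.
  by apply/eqP; rewrite -subr_eq0 -gmorB; apply/eqP/fg; rewrite gmorB rK subrr.
have hL j : linear (fun y => g j (r j y)).
  move=> c u v; rewrite -[u in LHS]rK -[v in LHS]rK -(@gm_linear _ _ _ _ _ f) rE.
  exact: gm_linear.
have hA j l a y : g l (r l (gact N j l a y)) = gact P j l a (g j (r j y)).
  by rewrite -[y in LHS]rK -gm_act rE gm_act.
by exists (GMor hL hA); apply: gmor_ext => j x; exact: rE.
Qed.

Lemma gsurj_epi M N P (f : gmor M N) (g h : gmor N P) : gsurj f ->
  gcomp g f = gcomp h f -> g = h.
Proof.
move=> fS e; apply: gmor_ext => j y; have [x <-] := fS j y.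
exact: (congr1 (fun q : gmor M P => q j x) e).
Qed.
End Morphisms.

(** * Comparison of projective resolutions *)

(** [Inv] is the property of one choice that makes the next one possible. *)
Lemma dependent_choice_nat (T : nat -> Type) (Inv : forall i, T i -> Prop)
    (R : forall i, T i -> T i.+1 -> Prop) (x0 : T 0%N) : Inv 0%N x0 ->
  (forall i x, Inv i x -> exists y, R i x y /\ Inv i.+1 y) ->
  exists f : forall i, T i, f 0%N = x0 /\ forall i, R i (f i) (f i.+1).
Proof.
move=> I0 step.
pose next i (x : {x : T i | Inv i x}) : {y : T i.+1 | R i (sval x) y /\ Inv i.+1 y} :=
  cid (step i (sval x) (svalP x)).
pose g := fix g i : {x : T i | Inv i x} :=
  if i is i'.+1 then exist _ (sval (next i' (g i'))) (svalP (next i' (g i'))).2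
  else exist _ x0 I0.
by exists (fun i => sval (g i)); split=> // i; exact: (svalP (next i (g i))).1.
Qed.

Section Presolutions.
Variables (k : fieldType) (s : side) (A : galg k).
Implicit Types M N X : gmod s A.

Lemma paug_diff M (P : presolution M) : gcomp (paug P) (pdiff P 0) = 0.
Proof. by apply: gmor_ext => j x; apply/pexact0; exists x. Qed.

Lemma pdiff_diff M (P : presolution M) i : gcomp (pdiff P i) (pdiff P i.+1) = 0.
Proof. by apply: gmor_ext => j x; apply/pexact; exists x. Qed.

(** [Q] is only asked to be a complex of projectives: besides a resolution, it may
    be a resolution with its first term removed, as in the horseshoe below. *)
Lemma chain_lift M (P : presolution M) (Q : nat -> gmod s A)
    (dQ : forall i, gmor (Q i.+1) (Q i)) (h : gmor (Q 0%N) M) :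
  (forall i, gprojective (Q i)) -> (forall i, gcomp (dQ i) (dQ i.+1) = 0) ->
  gcomp h (dQ 0%N) = 0 ->
  exists t : forall i, gmor (Q i) (P i),
    gcomp (paug P) (t 0%N) = h /\
    forall i, gcomp (pdiff P i) (t i.+1) = gcomp (t i) (dQ i).
Proof.
move=> Qp dd hd.
have [t0 t0h] : exists t0, gcomp (paug P) t0 = h.
  by apply: gprojective_lift => // j x; exact: paug_surj.
pose Inv i (t : gmor (Q i) (P i)) :=
  forall j x, exists y, pdiff P i j y = t j (dQ i j x).
have [||t [t0E tE]] := @dependent_choice_nat _ Inv
    (fun i t t' => gcomp (pdiff P i) t' = gcomp t (dQ i)) t0.
- by move=> j x; apply/pexact0; rewrite (gcomp_app t0h) (gcomp_app hd).
- move=> i t tI; have [||t' t'E] := @gprojective_lift _ _ _ (Q i.+1) _ _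
    (pdiff P i) (gcomp t (dQ i)).
  + exact: Qp.
  + exact: tI.
  exists t'; split=> // j x; apply/pexact.
  by rewrite (gcomp_app t'E) /= (gcomp_app (dd i)) gmor0.
by exists t; rewrite t0E.
Qed.

(** Projectivity of [Q] and exactness of [P] give the homotopy one degree at a time;
    what is carried along is that the remaining defect consists of cycles. *)
Lemma null_homotopic M N (P : presolution M) (Q : presolution N)
    (D : forall i, gmor (Q i) (P i)) : gcomp (paug P) (D 0%N) = 0 ->
  (forall i, gcomp (pdiff P i) (D i.+1) = gcomp (D i) (pdiff Q i)) ->
  exists h : forall i, gmor (Q i) (P i.+1), gcomp (pdiff P 0) (h 0%N) = D 0%N /\
    forall i, gcomp (pdiff P i.+1) (h i.+1) + gcomp (h i) (pdiff Q i) = D i.+1.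
Proof.
move=> D0 DE.
have [h0 h0E] : exists h0, gcomp (pdiff P 0) h0 = D 0%N.
  apply: gprojective_lift => [|j x]; first exact: pres_projective.
  by apply/pexact0; rewrite (gcomp_app D0).
pose Inv i (h : gmor (Q i) (P i.+1)) :=
  gcomp (pdiff P i) (D i.+1 - gcomp h (pdiff Q i)) = 0.
have [||h [h0' hE]] := @dependent_choice_nat _ Inv
    (fun i h h' => gcomp (pdiff P i.+1) h' = D i.+1 - gcomp h (pdiff Q i)) h0.
- by rewrite /Inv gcompBr gcompA h0E DE subrr.
- move=> i h hI.
  have [||h' h'E] := @gprojective_lift _ _ _ (Q i.+1) _ _ (pdiff P i.+1)
    (D i.+1 - gcomp h (pdiff Q i)).
  + exact: pres_projective.
  + by move=> j x; apply/pexact; rewrite (gcomp_app hI).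
  exists h'; split=> //; rewrite /Inv gcompBr DE gcompA h'E gcompBl -gcompA.
  by rewrite pdiff_diff gcomp0r subr0 subrr.
by exists h; rewrite h0'; split=> // i; rewrite hE subrK.
Qed.

Lemma null_homotopic_coboundary M N X (P : presolution M) (Q : presolution N)
    (D : forall i, gmor (Q i) (P i)) : gcomp (paug P) (D 0%N) = 0 ->
  (forall i, gcomp (pdiff P i) (D i.+1) = gcomp (D i) (pdiff Q i)) ->
  forall i (c : gmor (P i) X), gcomp c (pdiff P i) = 0 ->
  is_coboundary (P:=Q) (gcomp c (D i)).
Proof.
move=> D0 DE i c c0; have [h [h0 hE]] := null_homotopic D0 DE.
case: i c c0 => [|i] c c0; first by rewrite /= -h0 gcompA c0 gcomp0l.
by exists (gcomp c (h i)); rewrite -hE gcompDr !gcompA c0 gcomp0l add0r.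
Qed.

(** The identity of [M] lifts to [t : Q -> P] and to [r : P -> Q], and [r t] is
    homotopic to the identity of [Q]; hence [e] can be taken to be [c r]. *)
Lemma presolution_comparison M (P Q : presolution M) :
  exists t : forall i, gmor (Q i) (P i),
    (forall i, gcomp (pdiff P i) (t i.+1) = gcomp (t i) (pdiff Q i)) /\
    forall X i (c : gmor (Q i) X), gcomp c (pdiff Q i) = 0 ->
    exists e : gmor (P i) X, gcomp e (pdiff P i) = 0 /\
      is_coboundary (P:=Q) (c - gcomp e (t i)).
Proof.
have [t [t0 tE]] := chain_lift P (@pres_projective _ _ _ _ Q) (pdiff_diff Q) (paug_diff Q).
have [r [r0 rE]] := chain_lift Q (@pres_projective _ _ _ _ P) (pdiff_diff P) (paug_diff P).
exists t; split=> // X i c c0; exists (gcomp c (r i)).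
split; first by rewrite -gcompA -rE gcompA c0 gcomp0l.
pose D i := gid (Q i) - gcomp (r i) (t i).
have -> : c - gcomp (gcomp c (r i)) (t i) = gcomp c (D i).
  by rewrite gcompBr gcomp_idr gcompA.
apply: null_homotopic_coboundary c0.
  by rewrite gcompBr gcomp_idr gcompA r0 t0 subrr.
move=> l; rewrite gcompBr gcompBl gcomp_idr gcomp_idl gcompA rE -gcompA tE.
by rewrite gcompA.
Qed.

(** This is the vanishing of Ext^i(M, X) in degree 0, computed with [P]. *)
Definition ext_vanishes M (P : presolution M) (i : nat) X : Prop :=
  forall c : gmor (P i) X, gcomp c (pdiff P i) = 0 -> is_coboundary (P:=P) c.

Lemma is_coboundary_cocycle M (P : presolution M) X i (c : gmor (P i) X) :
  is_coboundary (P:=P) c -> gcomp c (pdiff P i) = 0.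
Proof.
case: i c => [|i] c /=; first by move=> ->; rewrite gcomp0l.
by move=> [b <-]; rewrite -gcompA pdiff_diff gcomp0r.
Qed.

Lemma is_coboundaryD M (P : presolution M) X i (b c : gmor (P i) X) :
  is_coboundary (P:=P) b -> is_coboundary (P:=P) c -> is_coboundary (P:=P) (b + c).
Proof. by move=> bP cP; rewrite -[b]scale1r; exact: is_coboundaryP. Qed.

Lemma coboundary_comp M (P : presolution M) N (Q : presolution N) X Y
    (t : forall i, gmor (Q i) (P i)) (g : gmor X Y) :
  (forall i, gcomp (pdiff P i) (t i.+1) = gcomp (t i) (pdiff Q i)) ->
  forall i (c : gmor (P i) X), is_coboundary (P:=P) c ->
  is_coboundary (P:=Q) (gcomp g (gcomp c (t i))).
Proof.
move=> tE [|i] c /=; first by move=> ->; rewrite gcomp0l gcomp0r.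
by move=> [b <-]; exists (gcomp g (gcomp b (t i))); rewrite -!gcompA tE.
Qed.

Lemma ext_vanishes_indep M (P Q : presolution M) i X :
  ext_vanishes P i X -> ext_vanishes Q i X.
Proof.
move=> Pv c c0; have [t [tE /(_ _ _ _ c0)[e [e0 ce]]]] := presolution_comparison P Q.
rewrite -[c](subrK (gcomp e (t i))); apply: is_coboundaryD => //.
rewrite -[gcomp e _]gcomp_idl; apply: coboundary_comp => //; exact: Pv.
Qed.

Lemma ext_vanishesP M i X :
  (forall x : Ext0 i M X, x = 0) <-> ext_vanishes (std_res M) i X.
Proof.
split=> [x0 c c0|v x].
  have := x0 (quo_pi (coboundaries _ _ _) (@mksub _ _ (cocycles (std_res M) X i) c c0)).
  rewrite -[RHS](lin0 (@quo_pi_linear k _ (coboundaries (std_res M) X i))).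
  by move/quo_piE; rewrite subr0.
rewrite -[x]quo_reprK -[RHS](lin0 (@quo_pi_linear k _ (coboundaries (std_res M) X i))).
by apply/quo_piE; rewrite subr0; exact: v (sub_valP (quo_repr x)).
Qed.
End Presolutions.

(** * Short exact sequences and the horseshoe resolution *)

Section Preimage.
Variables (k : fieldType) (s : side) (A : galg k) (M N : gmod s A) (f : gmor M N).
Variable S : gsub N.

Fact gpreim0 j : S j (f j 0).
Proof. by rewrite gmor0; exact: subspace0. Qed.
Fact gpreimP j c u v : S j (f j u) -> S j (f j v) -> S j (f j (c *: u + v)).
Proof. by rewrite gm_linear; exact: subspaceP. Qed.
Fact gpreim_act j l a u : S j (f j u) -> S l (f l (gact M j l a u)).
Proof. by rewrite gm_act; exact: gsub_act. Qed.
Definition gpreim : gsub M :=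
  @GSub _ _ _ M (fun j => @Subspace k (M j) _ (gpreim0 j) (@gpreimP j)) gpreim_act.
End Preimage.

Section DirectSum.
Variables (k : fieldType) (s : side) (A : galg k) (M N : gmod s A).

Definition gsum_act j l (a : A) (x : M j * N j) : M l * N l :=
  (gact M j l a x.1, gact N j l a x.2).
Arguments gsum_act : clear implicits.
Fact gsum_linear_l j l x : linear (fun a => gsum_act j l a x).
Proof. by move=> c a b; rewrite /gsum_act !gact_linear_l. Qed.
Fact gsum_linear_r j l a : linear (gsum_act j l a).
Proof. by move=> c u v; rewrite /gsum_act !gact_linear_r. Qed.
Fact gsum_act1 j x : gsum_act j j 1 x = x.
Proof. by rewrite /gsum_act !gact1 -surjective_pairing. Qed.
Fact gsum_actM j l p a b x : gsum_act l p a (gsum_act j l b x) =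
  gsum_act j p (smul s (zcomp (p - l) a) (zcomp (l - j) b)) x.
Proof. by rewrite /gsum_act /= !gactM. Qed.
Definition gsum : gmod s A :=
  @GMod k s A (fun j => (M j * N j)%type) gsum_act
    gsum_linear_l gsum_linear_r gsum_act1 gsum_actM.

Definition ginl : gmor M gsum.
Proof.
refine (@GMor k s A M gsum (fun j x => (x, 0)) _ _).
- by move=> j c u v; apply: injective_projections; rewrite /= ?scaler0 ?addr0.
- by move=> j l a x; apply: injective_projections; rewrite /= ?gact0.
Defined.
Definition ginr : gmor N gsum.
Proof.
refine (@GMor k s A N gsum (fun j x => (0, x)) _ _).
- by move=> j c u v; apply: injective_projections; rewrite /= ?scaler0 ?addr0.
- by move=> j l a x; apply: injective_projections; rewrite /= ?gact0.
Defined.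
Definition gfst : gmor gsum M :=
  @GMor k s A gsum M (fun j x => x.1) (fun j c u v => erefl) (fun j l a x => erefl).
Definition gsnd : gmor gsum N :=
  @GMor k s A gsum N (fun j x => x.2) (fun j c u v => erefl) (fun j l a x => erefl).

Lemma gsumE : gcomp ginl gfst + gcomp ginr gsnd = gid gsum.
Proof.
apply: gmor_ext => j x; rewrite gmorDE [RHS]surjective_pairing.
by apply: injective_projections; rewrite /= ?addr0 ?add0r.
Qed.

Lemma gsum_mor_ext X (f g : gmor gsum X) :
  gcomp f ginl = gcomp g ginl -> gcomp f ginr = gcomp g ginr -> f = g.
Proof.
move=> fg1 fg2; rewrite -[f]gcomp_idr -[g]gcomp_idr -gsumE !gcompDr !gcompA.
by rewrite fg1 fg2.
Qed.

Lemma gfst_inl : gcomp gfst ginl = gid M. Proof. exact: gmor_ext. Qed.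
Lemma gsnd_inl : gcomp gsnd ginl = 0. Proof. exact: gmor_ext. Qed.
Lemma gsnd_inr : gcomp gsnd ginr = gid N. Proof. exact: gmor_ext. Qed.

Lemma gsum_projective : gprojective M -> gprojective N -> gprojective gsum.
Proof.
move=> Mp Np X Y f g fS.
have [u uE] := Mp _ _ f (gcomp g ginl) fS; have [v vE] := Np _ _ f (gcomp g ginr) fS.
exists (gcomp u gfst + gcomp v gsnd) => j x.
rewrite gmorDE gmorD uE vE !gcompE -gmorD; congr (g j _).
by rewrite -[RHS]/(gid gsum j x) -gsumE gmorDE.
Qed.

Lemma gsum_fingen : gfingen M -> gfingen N -> gfingen gsum.
Proof.
move=> [p [t tP]] [q [u uP]].
pose w (i : 'I_(p + q)) : {j : int & gsum j} := match fintype.split i with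
  | inl a => @Tagged _ (tag (t a)) (fun j => gsum j) (ginl _ (tagged (t a)))
  | inr b => @Tagged _ (tag (u b)) (fun j => gsum j) (ginr _ (tagged (u b))) end.
exists (p + q)%N, w => S Sw.
have SM : forall j x, gpreim ginl S j x.
  by apply: tP => a; have := Sw (unsplit (inl a)); rewrite /w unsplitK.
have SN : forall j x, gpreim ginr S j x.
  by apply: uP => b; have := Sw (unsplit (inr b)); rewrite /w unsplitK.
move=> j x; have -> : x = 1 *: ginl j (gfst j x) + ginr j (gsnd j x).
  rewrite scale1r -[LHS]/(gid gsum j x) -gsumE gmorDE; congr (_ + _).
by apply: subspaceP; [exact: SM | exact: SN].
Qed.
End DirectSum.

Section ShortExact.
Variables (k : fieldType) (s : side) (A : galg k).
Implicit Types M N X : gmod s A.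

Definition short_exact M N P (f : gmor M N) (g : gmor N P) : Prop :=
  [/\ forall j, injective (f j), gsurj g
    & forall j y, g j y = 0 <-> exists x, f j x = y].

Lemma short_exact_comp M N P (f : gmor M N) (g : gmor N P) :
  short_exact f g -> gcomp g f = 0.
Proof. by move=> [_ _ e]; apply: gmor_ext => j x; apply/e; exists x. Qed.

Lemma short_exact_factor M N P X (f : gmor M N) (g : gmor N P) (h : gmor X N) :
  short_exact f g -> gcomp g h = 0 -> exists h', gcomp f h' = h.
Proof.
move=> [fI _ e] gh.
have im j x : exists y, f j y = h j x by apply/e; rewrite (gcomp_app gh).
pose r j x := sval (cid (im j x)).
have rE j x : f j (r j x) = h j x := svalP (cid (im j x)).
have rL j : linear (r j) by move=> c u v; apply: (fI j); rewrite gm_linear !rE gm_linear.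
have rA j l a x : r l (gact X j l a x) = gact M j l a (r j x).
  by apply: (fI l); rewrite gm_act !rE gm_act.
by exists (GMor rL rA); apply: gmor_ext => j x; exact: rE.
Qed.

Lemma short_exact_mono M N P X (f : gmor M N) (g : gmor N P) (h h' : gmor X M) :
  short_exact f g -> gcomp f h = gcomp f h' -> h = h'.
Proof.
move=> [fI _ _] e; apply: gmor_ext => j x; apply: (fI j).
exact: (congr1 (fun q : gmor X N => q j x) e).
Qed.

Lemma short_exact_lift M N P Q (f : gmor M N) (g : gmor N P) (h : gmor Q P) :
  short_exact f g -> gprojective Q -> exists h', gcomp g h' = h.
Proof.
by move=> [_ gS _] Qp; apply: gprojective_lift => // j x; exact: gS.
Qed.

Lemma gker_short_exact M N (f : gmor M N) : gsurj f -> short_exact (gincl (gker f)) f.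
Proof.
move=> fS; split=> // [j|j y]; first exact: gincl_inj.
split=> [y0|[x <-]]; last exact: (sub_valP x).
by exists (@mksub _ _ (gker f j) y y0).
Qed.

Definition gquo_map M (S : gsub M) : gmor M (gquo S) :=
  @GMor k s A M (gquo S) (fun j => quo_pi (S j)) (fun j => @quo_pi_linear k _ (S j))
    (fun j l a x => esym (gquo_actE S l a x)).

Lemma gquo_map0 M (S : gsub M) j x : gquo_map S j x = 0 <-> S j x.
Proof.
rewrite -[X in _ = X](lin0 (@quo_pi_linear k _ (S j))).
by rewrite -[gquo_map S j x]/(quo_pi (S j) x) quo_piE subr0.
Qed.

Lemma gquo_short_exact M (S : gsub M) : short_exact (gincl S) (gquo_map S).
Proof.
split=> [j|j y|j y]; first exact: gincl_inj.
  by exists (quo_repr y); exact: quo_reprK.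
split=> [/gquo_map0 Sy|[x <-]]; first by exists (mksub Sy).
by apply/gquo_map0; exact: sub_valP.
Qed.
End ShortExact.

Section Horseshoe.
Variables (k : fieldType) (s : side) (A : galg k).
Variables (M' M M'' : gmod s A) (f : gmor M' M) (g : gmor M M'').
Hypothesis fg : short_exact f g.
Variables (P' : presolution M') (P'' : presolution M'').

Local Notation Q i := (gsum (P' i) (P'' i)).

(** [sg] lifts the augmentation of [P''] to [M]. On the first differential of [P'']
    it takes values in [M'], and [t] extends the map obtained to a chain map from
    [P''], without its first term, to [P']. *)
Lemma horseshoe_maps : exists (sg : gmor (P'' 0%N) M)
    (t : forall i, gmor (P'' i.+1) (P' i)),
  [/\ gcomp g sg = paug P'',
      gcomp f (gcomp (paug P') (t 0%N)) = gcomp sg (pdiff P'' 0)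
    & forall i, gcomp (pdiff P' i) (t i.+1) = gcomp (t i) (pdiff P'' i.+1)].
Proof.
have [sg sgE] := short_exact_lift (paug P'') fg (@pres_projective _ _ _ _ P'' 0%N).
have [h hE] : exists h, gcomp f h = gcomp sg (pdiff P'' 0).
  by apply: short_exact_factor fg _; rewrite gcompA sgE paug_diff.
have h0 : gcomp h (pdiff P'' 1) = 0.
  apply: (short_exact_mono fg); rewrite gcomp0r gcompA hE -gcompA pdiff_diff.
  by rewrite gcomp0r.
have [t [t0 tE]] := chain_lift P' (fun i => @pres_projective _ _ _ _ P'' i.+1)
  (fun i => pdiff_diff P'' i.+1) h0.
by exists sg, t; split=> //; rewrite t0.
Qed.

Variables (sg : gmor (P'' 0%N) M) (t : forall i, gmor (P'' i.+1) (P' i)).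
Hypothesis sgE : gcomp g sg = paug P''.
Hypothesis t0E : gcomp f (gcomp (paug P') (t 0%N)) = gcomp sg (pdiff P'' 0).
Hypothesis tE : forall i, gcomp (pdiff P' i) (t i.+1) = gcomp (t i) (pdiff P'' i.+1).

Definition horseshoe_aug : gmor (Q 0%N) M :=
  gcomp (gcomp f (paug P')) (gfst _ _) + gcomp sg (gsnd _ _).
(** The sign makes the square of the differential vanish. *)
Definition horseshoe_diff i : gmor (Q i.+1) (Q i) :=
  gcomp (ginl _ _) (gcomp (pdiff P' i) (gfst _ _) + gcomp (t i) (gsnd _ _))
  - gcomp (ginr _ _) (gcomp (pdiff P'' i) (gsnd _ _)).

Lemma horseshoe_augE j x' x'' :
  horseshoe_aug j (x', x'') = f j (paug P' j x') + sg j x''.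
Proof. by rewrite /horseshoe_aug gmorDE. Qed.

Lemma horseshoe_diffE i j x' x'' : horseshoe_diff i j (x', x'') =
  (pdiff P' i j x' + t i j x'', - pdiff P'' i j x'').
Proof.
rewrite /horseshoe_diff gmorBE !gcompE gmorDE.
by apply: injective_projections; rewrite /= ?subr0 ?sub0r.
Qed.

Fact horseshoe_aug_surj : gsurj horseshoe_aug.
Proof.
move=> j y; have [x'' x''E] := @paug_surj _ _ _ _ P'' j (g j y).
have [_ _ ex] := fg.
have /ex[z zE] : g j (y - sg j x'') = 0 by rewrite gmorB (gcomp_app sgE) x''E subrr.
have [x' x'E] := @paug_surj _ _ _ _ P' j z.
by exists (x', x''); rewrite horseshoe_augE x'E zE subrK.
Qed.

Fact horseshoe_exact0 j x :
  horseshoe_aug j x = 0 <-> exists y, horseshoe_diff 0 j y = x.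
Proof.
case: x => x' x''; rewrite horseshoe_augE; split=> [e|[[y' y'']]]; last first.
  rewrite horseshoe_diffE => -[<- <-].
  rewrite gmorD (gcomp_app (paug_diff P')) add0r.
  by rewrite (gcomp_app (f := gcomp _ _) t0E) /= -gmorD subrr gmor0.
have /pexact0[y'' y''E] : paug P'' j x'' = 0.
  rewrite -(gcomp_app sgE) -[RHS](gmor0 g j) -e gmorD.
  by rewrite (gcomp_app (short_exact_comp fg)) add0r.
have /pexact0[y' y'E] : paug P' j (x' + t 0%N j y'') = 0.
  have [fI _ _] := fg; apply: (fI j); rewrite gmor0 gmorD gmorD.
  by rewrite (gcomp_app (f := gcomp _ _) t0E) /= y''E.
exists (y', - y''); rewrite horseshoe_diffE y'E.
by rewrite !gmorN opprK y''E addrK.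
Qed.

Fact horseshoe_exact i j x :
  horseshoe_diff i j x = 0 <-> exists y, horseshoe_diff i.+1 j y = x.
Proof.
case: x => x' x''; rewrite horseshoe_diffE; split=> [[e1 e2]|[[y' y'']]]; last first.
  rewrite horseshoe_diffE => -[<- <-].
  rewrite gmorD (gcomp_app (pdiff_diff P' i)) add0r (gcomp_app (tE i)) /=.
  by rewrite !gmorN (gcomp_app (pdiff_diff P'' i)) subrr !oppr0.
have /pexact[y'' y''E] : pdiff P'' i j x'' = 0.
  by apply: oppr_inj; rewrite e2 oppr0.
have /pexact[y' y'E] : pdiff P' i j (x' + t i.+1 j y'') = 0.
  by rewrite gmorD (gcomp_app (tE i)) /= y''E.
exists (y', - y''); rewrite horseshoe_diffE y'E.
by rewrite !gmorN opprK y''E addrK.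
Qed.

Definition horseshoe : presolution M :=
  @PResolution k s A M (fun i => Q i) horseshoe_diff horseshoe_aug
    (fun i => gsum_projective (@pres_projective _ _ _ _ P' i)
      (@pres_projective _ _ _ _ P'' i))
    horseshoe_aug_surj horseshoe_exact0 horseshoe_exact.

Lemma horseshoe_diff_inl i :
  gcomp (horseshoe_diff i) (ginl _ _) = gcomp (ginl _ _) (pdiff P' i).
Proof.
apply: gmor_ext => j x; rewrite gcompE -[ginl _ _ j x]/(x, 0) horseshoe_diffE.
by rewrite !gmor0 oppr0 addr0.
Qed.

Lemma horseshoe_diff_inr i : gcomp (horseshoe_diff i) (ginr _ _) =
  gcomp (ginl _ _) (t i) - gcomp (ginr _ _) (pdiff P'' i).
Proof.
apply: gmor_ext => j x; rewrite gcompE -[ginr _ _ j x]/(0, x) horseshoe_diffE.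
rewrite !gmor0 add0r gmorBE.
by apply: injective_projections; rewrite /= ?subr0 ?sub0r.
Qed.

(** The resolution is split in each degree: a cocycle is first corrected by a
    coboundary so as to vanish on [P'], then bounded on [P'']. *)
Lemma horseshoe_ext_vanishes i X :
  ext_vanishes P' i X -> ext_vanishes P'' i X -> ext_vanishes horseshoe i X.
Proof.
move=> v' v'' c cd.
change (gcomp c (horseshoe_diff i) = 0) in cd.
have /v' b' : gcomp (gcomp c (ginl _ _)) (pdiff P' i) = 0.
  by rewrite -gcompA -horseshoe_diff_inl gcompA cd gcomp0l.
(* The component of the differential from [P''] to [P'] is invisible to a cochain
   that vanishes on [P']. *)
have inr (c1 : gmor (Q i) X) : gcomp c1 (horseshoe_diff i) = 0 ->
    gcomp c1 (ginl _ _) = 0 -> gcomp (gcomp c1 (ginr _ _)) (pdiff P'' i) = 0.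
  move=> c1d c10; have := horseshoe_diff_inr i.
  move/(congr1 (fun h => gcomp c1 h)); rewrite gcompA c1d gcomp0l gcompBr !gcompA.
  by rewrite c10 gcomp0l sub0r => /esym/eqP; rewrite oppr_eq0 => /eqP.
case: i c cd b' v' v'' inr => [|i] c cd b' v' v'' inr.
  apply: gsum_mor_ext; rewrite gcomp0l; first exact: b'.
  by apply: v''; exact: inr.
case: b' => b' b'E; pose c1 := c - gcomp (gcomp b' (gfst _ _)) (horseshoe_diff i).
have c1l : gcomp c1 (ginl _ _) = 0.
  rewrite gcompBl -[gcomp (gcomp _ (horseshoe_diff i)) _]gcompA horseshoe_diff_inl.
  by rewrite -!gcompA [gcomp (gfst _ _) _]gcompA gfst_inl gcomp_idl b'E subrr.
have dd : gcomp (horseshoe_diff i) (horseshoe_diff i.+1) = 0 := pdiff_diff horseshoe i.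
have c1d : gcomp c1 (horseshoe_diff i.+1) = 0.
  by rewrite gcompBl cd -!gcompA dd !gcomp0r subrr.
have [b'' b''E] := v'' _ (inr _ c1d c1l).
exists (gcomp b' (gfst _ _) - gcomp b'' (gsnd _ _)).
change (gcomp (gcomp b' (gfst _ _) - gcomp b'' (gsnd _ _)) (horseshoe_diff i) = c).
rewrite gcompBl; suff -> : gcomp (gcomp b'' (gsnd _ _)) (horseshoe_diff i) = - c1.
  by rewrite opprK /c1 addrC subrK.
apply: gsum_mor_ext.
  rewrite -gcompA horseshoe_diff_inl -!gcompA [gcomp (gsnd _ _) _]gcompA gsnd_inl.
  by rewrite gcomp0l gcomp0r gcompNl c1l oppr0.
rewrite -gcompA horseshoe_diff_inr -gcompA gcompBr !gcompA gsnd_inl gsnd_inr.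
by rewrite gcomp0l gcomp_idl sub0r gcompNr b''E gcompNl.
Qed.
End Horseshoe.

(** * Shifts of resolutions *)

Section Transport.
Variables (k : fieldType) (s : side) (A : galg k).
Implicit Types M N X : gmod s A.

(** Acting by 1 between equal degrees is the transport along that equality. *)
Lemma gact_one_cancel M j l x : j = l -> gact M l j 1 (gact M j l 1 x) = x.
Proof. by move=> jl; case: l / jl; rewrite !gact1. Qed.

Lemma gact_one_act M j j' l l' a x : j = j' -> l = l' ->
  gact M j' l' a (gact M j j' 1 x) = gact M l l' 1 (gact M j l a x).
Proof. by move=> jj ll; case: j' / jj; case: l' / ll; rewrite !gact1. Qed.

Definition shift_sub M (S : gsub M) e : gsub (shift M e) :=
  @GSub k s A (shift M e) (fun j => S (e + j))
    (fun j l => @gsub_act _ _ _ M S (e + j) (e + l)).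

Section Reshift.
Variable d : int.

(** Shifting by [d] is adjoint to shifting by [- d]; the two are inverse only up to
    the transports above, since [- d + (d + j)] does not reduce to [j]. *)
Definition unshift M X (f : gmor (shift M d) X) : gmor M (shift X (- d)).
Proof.
refine (@GMor k s A M (shift X (- d))
  (fun j x => f (- d + j) (gact M j (d + (- d + j)) 1 x)) _ _).
- by move=> j c u v; rewrite gact_linear_r; exact: (@gm_linear _ _ _ _ _ f).
move=> j l a x; rewrite -[RHS](@gm_act _ _ _ _ _ f); congr (f _ _).
by apply: esym; apply: (@gact_one_act M); rewrite addNKr.
Defined.

Definition reshift M X (g : gmor M (shift X (- d))) : gmor (shift M d) X.
Proof.
refine (@GMor k s A (shift M d) X
  (fun j x => gact X (- d + (d + j)) j 1 (g (d + j) x)) _ _).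
- by move=> j c u v; rewrite (@gm_linear _ _ _ _ _ g (d + j)) gact_linear_r.
move=> j l a x; rewrite (@gm_act _ _ _ _ _ g (d + j) (d + l)).
by apply: esym; apply: (@gact_one_act X); rewrite addKr.
Defined.

Lemma unshiftK M X (f : gmor (shift M d) X) : reshift (unshift f) = f.
Proof.
apply: gmor_ext => j x; rewrite -[LHS]/(gact X _ j 1 (f _ _)) -gm_act.
by congr (f _ _); apply: (@gact_one_cancel M); rewrite addNKr.
Qed.

Lemma unshift_comp M M' X (f : gmor (shift M d) X) (q : gmor M' M) :
  unshift (gcomp f (shift_map q d)) = gcomp (unshift f) q.
Proof. by apply: gmor_ext => j x; rewrite /= gm_act. Qed.

Lemma reshift_comp M M' X (g : gmor M (shift X (- d))) (q : gmor M' M) :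
  reshift (gcomp g q) = gcomp (reshift g) (shift_map q d).
Proof. exact: gmor_ext. Qed.

Lemma reshift_comp_l M X Y (p : gmor X Y) (g : gmor M (shift X (- d))) :
  reshift (gcomp (shift_map p (- d)) g) = gcomp p (reshift g).
Proof. by apply: gmor_ext => j x; rewrite /= gm_act. Qed.

Lemma reshift0 M X : reshift (0 : gmor M (shift X (- d))) = 0.
Proof. by apply: gmor_ext => j x; rewrite /= gact0. Qed.

Lemma unshift0 M X : unshift (0 : gmor (shift M d) X) = 0.
Proof. exact: gmor_ext. Qed.

Lemma shift_projective M : gprojective M -> gprojective (shift M d).
Proof.
move=> Mp X Y f g fS.
have [|h hE] := Mp _ _ (shift_map f (- d)) (unshift g); first by move=> j y; exact: fS.
exists (reshift h) => j x; apply: gcomp_app.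
by rewrite -reshift_comp_l -[RHS]unshiftK; congr reshift; exact: gmor_ext.
Qed.

Lemma shift_fingen M : gfingen M -> gfingen (shift M d).
Proof.
move=> [r [t tP]].
exists r, (fun i => @Tagged _ (- d + tag (t i)) (fun j => shift M d j)
  (gact M (tag (t i)) (d + (- d + tag (t i))) 1 (tagged (t i)))) => S St j x.
have /(_ (d + j) x) Sx :
    forall j x, gpreim (unshift (gid (shift M d))) (shift_sub S (- d)) j x.
  by apply: tP => i; exact: (St i).
rewrite -[x](@gact_one_cancel M _ (d + (- d + (d + j)))); last by rewrite addNKr.
exact: (@gsub_act _ _ _ _ S (- d + (d + j)) j 1 _ Sx).
Qed.
End Reshift.

Definition unshift_shift M d : gmor (shift (shift M d) (- d)) M.
Proof.
refine (@GMor k s A (shift (shift M d) (- d)) M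
  (fun j x => gact M (d + (- d + j)) j 1 x) _ _).
- by move=> j c u v; exact: (@gact_linear_r _ _ _ M).
by move=> j l a x; apply: esym; apply: (@gact_one_act M); rewrite addNKr.
Defined.

Lemma unshift_shift_bij M d j : bijective (unshift_shift M d j).
Proof.
by exists (gact M j (d + (- d + j)) 1) => x; apply: (@gact_one_cancel M); rewrite addNKr.
Qed.

Definition shift_shift M a b : gmor (shift (shift M a) b) (shift M (a + b)).
Proof.
refine (@GMor k s A (shift (shift M a) b) (shift M (a + b))
  (fun j x => gact M (a + (b + j)) (a + b + j) 1 x) _ _).
- by move=> j c u v; exact: (@gact_linear_r _ _ _ M).
by move=> j l a' x; apply: esym; apply: (@gact_one_act M); rewrite addrA.
Defined.

Definition shift_shift_inv M a b : gmor (shift M (a + b)) (shift (shift M a) b).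
Proof.
refine (@GMor k s A (shift M (a + b)) (shift (shift M a) b)
  (fun j x => gact M (a + b + j) (a + (b + j)) 1 x) _ _).
- by move=> j c u v; exact: (@gact_linear_r _ _ _ M).
by move=> j l a' x; apply: esym; apply: (@gact_one_act M); rewrite addrA.
Defined.

Lemma shift_shiftK M a b : gcomp (shift_shift_inv M a b) (shift_shift M a b) = gid _.
Proof. by apply: gmor_ext => j x; apply: (@gact_one_cancel M); rewrite addrA. Qed.

Section ShiftResolution.
Variables (M : gmod s A) (P : presolution M) (d : int).

Fact shift_res_surj : gsurj (shift_map (paug P) d).
Proof. by move=> j y; exact: paug_surj. Qed.

Definition shift_res : presolution (shift M d) :=
  @PResolution k s A (shift M d) (fun i => shift (P i) d)
    (fun i => shift_map (pdiff P i) d) (shift_map (paug P) d)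
    (fun i => @shift_projective d _ (@pres_projective _ _ _ _ P i)) shift_res_surj
    (fun j => @pexact0 _ _ _ _ P (d + j)) (fun i j => @pexact _ _ _ _ P i (d + j)).

Lemma shift_ext_vanishes i X :
  ext_vanishes P i (shift X (- d)) -> ext_vanishes shift_res i X.
Proof.
move=> v c c0; change (gcomp c (shift_map (pdiff P i) d) = 0) in c0.
have {v} := v (unshift c); rewrite -unshift_comp c0 unshift0 => /(_ erefl).
case: i c {c0} => [|i] c /=.
  by move=> c0; rewrite -[c]unshiftK c0 reshift0.
by move=> [b bE]; exists (reshift b); rewrite -[RHS]unshiftK -bE reshift_comp.
Qed.
End ShiftResolution.

Lemma ext_vanishes_retract M (P : presolution M) i X Y (u : gmor X Y) (v : gmor Y X) :
  gcomp v u = gid X -> ext_vanishes P i Y -> ext_vanishes P i X.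
Proof.
move=> vu Yv c c0; rewrite -[c]gcomp_idl -vu -gcompA -[gcomp u c]gcomp_idr.
apply: (coboundary_comp (t := fun i => gid (P i))) => [l|]; first exact: gmor_ext.
by apply: Yv; rewrite -gcompA c0 gcomp0r.
Qed.

Section IsoResolution.
Variables (M N : gmod s A) (f : gmor M N) (P : presolution M).
Hypothesis fB : forall j, bijective (f j).

Fact iso_res_surj : gsurj (gcomp f (paug P)).
Proof.
move=> j y; have [g _ gK] := fB j; have [x xE] := @paug_surj _ _ _ _ P j (g y).
by exists x; rewrite /= xE gK.
Qed.
Fact iso_res_exact0 j x : gcomp f (paug P) j x = 0 <-> exists y, pdiff P 0 j y = x.
Proof.
rewrite -pexact0 gcompE; split=> [|->]; last exact: gmor0.
by rewrite -[RHS](gmor0 f j) => /(bij_inj (fB j)).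
Qed.
Definition iso_res : presolution N :=
  @PResolution k s A N P (pdiff P) (gcomp f (paug P))
    (@pres_projective _ _ _ _ P) iso_res_surj iso_res_exact0 (@pexact _ _ _ _ P).
End IsoResolution.
End Transport.

(** * Ext of the truncations of the algebra *)

Section ConcentratedExt.
Variables (k : fieldType) (s : side) (A : galg k) (n : nat).
Implicit Types M N X : gmod s A.

(** Finite generation and vanishing are asked of one resolution because both are
    passed on by the horseshoe. All shifts of the algebra occur: they give the
    vanishing of Ext^i(M, A) in every degree. *)
Definition fg_ext_concentrated M : Prop := exists P : presolution M,
  (forall i, gfingen (P i)) /\
  forall i e, i <> n -> ext_vanishes P i (shift (reg s A) e).

Lemma fg_ext_concentrated_iso M N (f : gmor M N) : (forall j, bijective (f j)) ->
  fg_ext_concentrated M -> fg_ext_concentrated N.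
Proof. by move=> fB [P [Pf Pv]]; exists (iso_res P fB). Qed.

Lemma fg_ext_concentrated_shift M d :
  fg_ext_concentrated M -> fg_ext_concentrated (shift M d).
Proof.
move=> [P [Pf Pv]]; exists (shift_res P d); split=> [i|i e ni].
  exact: shift_fingen.
apply: shift_ext_vanishes; apply: ext_vanishes_retract (shift_shiftK _ _ _) _.
exact: Pv.
Qed.

Lemma fg_ext_concentrated_ext M N P (f : gmor M N) (g : gmor N P) :
  short_exact f g -> fg_ext_concentrated M -> fg_ext_concentrated P ->
  fg_ext_concentrated N.
Proof.
move=> fg [Q [Qf Qv]] [R [Rf Rv]]; have [sg [t [sgE t0E tE]]] := horseshoe_maps fg Q R.
exists (horseshoe fg sgE t0E tE); split=> [i|i e ni]; first exact: gsum_fingen.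
by apply: horseshoe_ext_vanishes; [exact: Qv | exact: Rv].
Qed.

Lemma fg_ext_concentrated_trivial M : gtrivial M -> fg_ext_concentrated M.
Proof.
move=> M0; have proj : gprojective M.
  by move=> X Y f g _; exists 0 => j x; rewrite (M0 _ x) !gmor0.
have surj : gsurj (0 : gmor M M) by move=> j y; exists 0; rewrite (M0 _ y).
have ex j (x : M j) : (0 : gmor M M) j x = 0 <-> exists y, (0 : gmor M M) j y = x.
  by split=> // _; exists 0; rewrite (M0 _ x).
exists (@PResolution k s A M (fun _ => M) (fun _ => 0) 0 (fun _ => proj) surj ex
  (fun _ => ex)); split=> [i|i e _ c _].
  have t : 'I_0 -> {j : int & M j} by case.
  exists 0%N, t => S _ j x.
  by rewrite (M0 _ x); exact: subspace0.
have -> : c = 0 by apply: gmor_ext => j x; rewrite (M0 _ x) gmor0.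
exact: is_coboundary0.
Qed.

Section Cyclic.
Variables (M : gmod s A) (d : int) (y : M d).

Fact gcyclic0 j : exists a, gact M d j a y = 0.
Proof. by exists 0; exact: lin0 (@gact_linear_l _ _ _ M d j y). Qed.
Fact gcyclicP j c u v : (exists a, gact M d j a y = u) ->
  (exists a, gact M d j a y = v) -> exists a, gact M d j a y = c *: u + v.
Proof. by move=> [a <-] [b <-]; exists (c *: a + b); exact: gact_linear_l. Qed.
Fact gcyclic_act j l a u : (exists b, gact M d j b y = u) ->
  exists b, gact M d l b y = gact M j l a u.
Proof. by move=> [b <-]; eexists; rewrite gactM. Qed.
Definition gcyclic : gsub M :=
  @GSub k s A M (fun j => @Subspace k (M j) _ (gcyclic0 j) (@gcyclicP j)) gcyclic_act.

(** Under the next three hypotheses the submodule generated by [y] is the line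
    through [y]; [L] is this line moved to degree 0. *)
Hypothesis y0 : y <> 0.
Hypothesis y_eigen : forall a, exists c : k, gact M d d a y = c *: y.
Hypothesis y_socle : forall j a, j <> d -> gact M d j a y = 0.

Let L := shift (gsubmod gcyclic) d.

Lemma cyclic_concentrated : concentrated0 L.
Proof.
move=> j x j0; apply: sub_val_inj; have [a aE] := sub_valP x.
by rewrite -aE y_socle // => /eqP; rewrite -subr_eq0 addrC addKr => /eqP.
Qed.

Lemma cyclic_simple : gsimple L.
Proof.
pose y' : L 0 := @mksub _ _ (gcyclic (d + 0)) (gact M d (d + 0) 1 y) (ex_intro _ 1 erefl).
have y'0 : y' <> 0.
  move=> /(congr1 (fun z => gact M (d + 0) d 1 (sub_val z))).
  by rewrite /= gact_one_cancel ?addr0 // gact0.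
have L0 (x : L 0) : exists c, x = c *: y'.
  have [a aE] := sub_valP x; have [c cE] := y_eigen a; exists c; apply: sub_val_inj.
  rewrite -aE /= -(linZ (@gact_linear_r _ _ _ M d (d + 0) 1)) -cE.
  by rewrite -(@gact_one_act _ _ _ M d d d (d + 0)) ?addr0 // gact1.
split; first by exists 0, y'.
move=> S; have [[x [Sx x0]]|nS] := pselect (exists x : L 0, S 0 x /\ x <> 0); last first.
  left=> j x Sx; apply: contrapT => x0; have [j0|j0] := pselect (j = 0); last first.
    exact/x0/cyclic_concentrated.
  by move: j0 x Sx x0 => -> x Sx x0; apply: nS; exists x.
right; have [c cE] := L0 x; have Sy : S 0 y'.
  have c0 : c != 0 by apply/eqP => c0; apply: x0; rewrite cE c0 scale0r.
  by rewrite -[y']scale1r -(mulVf c0) -scalerA -cE; exact: subspaceZ.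
move=> j z; have [j0|j0] := pselect (j = 0); last first.
  by rewrite (cyclic_concentrated z j0); exact: subspace0.
by move: j0 z => -> z; have [b ->] := L0 z; exact: subspaceZ.
Qed.
End Cyclic.

Hypothesis simple_concentrated : forall S : gmod s A,
  gsimple S -> concentrated0 S -> fg_ext_concentrated S.

(** An eigenvector spans a submodule that is zero or a shifted simple module. It
    is peeled off, and the other vectors still span the quotient. *)
Lemma fg_ext_concentrated_eigen M d (ys : seq (M d)) :
  (forall j (x : M j), j <> d -> x = 0) ->
  (forall y, y \in ys -> forall a, exists c : k, gact M d d a y = c *: y) ->
  (forall S : subspace (M d), (forall y, y \in ys -> S y) -> forall x, S x) ->
  fg_ext_concentrated M.
Proof.
move ysr: (size ys) => r.
elim: r M ys ysr => [|r IH] M [|y ys] // ysr Md ys_eigen ys_span.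
  apply: fg_ext_concentrated_trivial => j x.
  have [jd|/Md//] := pselect (j = d); move: jd x => -> x.
  have P0 (c : k) (u v : M d) : u = 0 -> v = 0 -> c *: u + v = 0.
    by move=> -> ->; rewrite scaler0 addr0.
  exact: (ys_span (@Subspace k (M d) (fun x => x = 0) erefl P0)).
have y_eigen := ys_eigen y (mem_head _ _).
have quo : fg_ext_concentrated (gquo (gcyclic y)).
  apply: (IH (gquo (gcyclic y)) [seq gquo_map (gcyclic y) d x | x <- ys]).
  - by rewrite size_map; case: ysr.
  - move=> j x jd; rewrite -[x]quo_reprK (Md _ (quo_repr x) jd).
    exact: lin0 (@quo_pi_linear _ _ _).
  - move=> _ /mapP[x xs ->] a; have [|c cE] := ys_eigen x _ a.
      by rewrite inE xs orbT.
    exists c; rewrite [LHS]gquo_actE cE; exact: linZ (@quo_pi_linear _ _ _) _ _.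
  move=> S Sys x; rewrite -[x]quo_reprK; move: (quo_repr x) => {}x.
  have P0 : S (quo_pi (gcyclic y d) 0).
    by rewrite (lin0 (@quo_pi_linear _ _ _)); exact: subspace0.
  have PP c u v : S (quo_pi (gcyclic y d) u) -> S (quo_pi (gcyclic y d) v) ->
      S (quo_pi (gcyclic y d) (c *: u + v)).
    by rewrite quo_pi_linear; exact: subspaceP.
  apply: (ys_span (@Subspace k (M d) (fun x => S (quo_pi (gcyclic y d) x)) P0 PP)).
  move=> z; rewrite inE => /orP[/eqP->|zys]; last exact/Sys/map_f.
  rewrite /= (_ : quo_pi _ y = 0); first exact: subspace0.
  by apply/(gquo_map0 (gcyclic y)); exists 1; rewrite gact1.
apply: fg_ext_concentrated_ext (gquo_short_exact (gcyclic y)) _ quo.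
have [y0|y0] := pselect (y = 0).
  apply: fg_ext_concentrated_trivial => j x; apply: sub_val_inj.
  by have [a <-] := sub_valP x; rewrite y0 gact0.
have y_socle j a : j <> d -> gact M d j a y = 0 by exact: Md.
apply: fg_ext_concentrated_iso (unshift_shift_bij _ d) _.
apply: fg_ext_concentrated_shift; apply: simple_concentrated.
  exact: cyclic_simple.
exact: cyclic_concentrated.
Qed.

(** The primitive idempotents of the degree-zero part add up to 1, and multiplying
    by one of them turns any homogeneous element into an eigenvector. *)
Lemma homog_eigen_span (d : nat) : exists ys : seq (reg s A d),
  (forall y, y \in ys -> forall a, exists c : k, gact (reg s A) d d a y = c *: y) /\
  forall S : subspace (reg s A d), (forall y, y \in ys -> S y) -> forall x, S x.
Proof.
have [r [f [fL fI f0 fM f1]]] := hcomp0_split A.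
have [t tP] := hcomp_fin A d.
pose e (i : 'I_r) : A := f [ffun l => if l == i then 1 else 0].
have eH i : homog 0 (e i) by apply/f0; eexists.
have yH i (j : 'I_(size t)) : homog_space A d (smul s (e i) (hcomp d t`_j)).
  by rewrite -[Posz d]add0r; apply: homog_smul => //; exact: (zcompK d).
pose y i j : reg s A d := mksub (yH i j).
pose ys := [seq y i j | i <- enum 'I_r, j <- enum 'I_(size t)].
exists ys; split=> [_ /allpairsP[[i j] [_ _ ->]] a|S Sys x].
  have /f0[c cE] : hcomp 0 (hcomp 0 a) = hcomp 0 a by rewrite hcomp_hcomp.
  exists (c i); apply: sub_val_inj; rewrite /= /regact subrr /= -cE smulA.
  rewrite (_ : smul s (f c) (e i) = c i *: e i).
    exact: linZ (@smul_linear_l _ _ _ _) _ _.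
  rewrite -(linZ fL); have -> : smul s (f c) (e i) =
      f [ffun l => c l * [ffun l => if l == i then 1 else 0 : k^o] l].
    by case: s => /=; rewrite -fM //; congr f; apply/ffunP => l; rewrite !ffunE mulrC.
  congr f; apply/ffunP => l; rewrite !ffunE; case: eqP => [->|_]; first by [].
  by rewrite mulr0 /= scaler0.
have Sy i j : S (y i j) by apply: Sys; apply/allpairsP; exists (i, j); rewrite !mem_enum.
have Ssum (I : finType) (F : I -> reg s A d) : (forall i, S (F i)) -> S (\sum_i F i).
  move=> SF; apply: (big_ind (fun z => S z)) => //; first exact: subspace0.
  by move=> u v Su Sv; rewrite -[u]scale1r; exact: subspaceP.
have [c cE] := tP _ (sub_valP x).
have -> : x = \sum_(j < size t) c j *: \sum_(i < r) y i j.
  apply: sub_val_inj; rewrite (lin_sum (@sub_val_linear _ _ _)).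
  have xE : hcomp d (sub_val x) = sub_val x := sub_valP x.
  rewrite -{1}xE cE (lin_sum (@hcomp_linear _ A d)); apply: eq_bigr => j _.
  rewrite (linZ (@hcomp_linear _ A d)) (linZ (@sub_val_linear _ _ _)); congr (_ *: _).
  rewrite (lin_sum (@sub_val_linear _ _ _)) /=.
  rewrite -(lin_sum (@smul_linear_l _ A s (hcomp d t`_j))) -(lin_sum fL).
  rewrite (_ : \sum_(i < r) _ = [ffun=> 1]) ?f1 ?smul1r //.
  apply/ffunP => l; rewrite sum_ffunE ffunE (bigD1 l) //= ffunE eqxx big1 ?addr0 //.
  by move=> i il; rewrite ffunE eq_sym (negbTE il).
by apply: (Ssum) => j; apply: subspaceZ; apply: (Ssum).
Qed.

(** The kernel of the projection of a truncation onto the previous one is a single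
    component of the algebra, spanned by eigenvectors. *)
Lemma fg_ext_concentrated_trunc p : fg_ext_concentrated (reg_trunc s A p).
Proof.
elim: p => [|p IH].
  apply: fg_ext_concentrated_trivial => j x; rewrite -[x]quo_reprK.
  apply/(gquo_map0 (reg_ge s A 0)); move: (quo_repr x) => {}x.
  case: j x => j x; first by left.
  by right; apply: sub_val_inj; rewrite -(sub_valP x).
have pS : gsurj (trunc_proj s A (leqnSn p)).
  move=> j y; exists (quo_pi _ (quo_repr y)).
  by rewrite [LHS](gquo_projE (@reg_ge_mono _ s A _ _ (leqnSn p))) quo_reprK.
apply: fg_ext_concentrated_ext (gker_short_exact pS) _ IH.
set K := gker _.
have KE j (x : reg s A j) : K j (quo_pi (reg_ge s A p.+1 j) x) <-> reg_ge s A p j x.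
  rewrite -(gquo_map0 (reg_ge s A p)).
  by rewrite /K /= (gquo_projE (@reg_ge_mono _ s A _ _ (leqnSn p))).
have Kp (x : reg s A p) : K p (quo_pi (reg_ge s A p.+1 p) x) by apply/KE; left.
pose v (x : reg s A p) : gsubmod K p := mksub (Kp x).
have [ys [ysE ysS]] := homog_eigen_span p.
apply: (@fg_ext_concentrated_eigen _ p [seq v x | x <- ys]).
- move=> j x jp; apply: sub_val_inj; have := sub_valP x.
  rewrite -[sub_val x]quo_reprK => /KE px; apply/(gquo_map0 (reg_ge s A p.+1)).
  case: px => [px|]; last by right.
  by left; rewrite intS lez1D Order.POrderTheory.lt_def px andbT; apply/eqP.
- move=> _ /mapP[x xs ->] a; have [c cE] := ysE x xs a; exists c.
  apply: sub_val_inj; rewrite /= gquo_actE cE; exact: linZ (@quo_pi_linear _ _ _) _ _.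
move=> S Sys x.
have P0 : S (v 0).
  rewrite (_ : v _ = 0); first exact: subspace0.
  by apply: sub_val_inj; exact: lin0 (@quo_pi_linear _ _ _).
have PP c u w : S (v u) -> S (v w) -> S (v (c *: u + w)).
  rewrite (_ : v (c *: u + w) = c *: v u + v w).
    exact: subspaceP.
  by apply: sub_val_inj; exact: quo_pi_linear.
have := ysS (@Subspace k (reg s A p) (fun x => S (v x)) P0 PP) _
  (quo_repr (sub_val x)).
rewrite /= (_ : v _ = x); last by apply: sub_val_inj; exact: quo_reprK.
by apply=> y yy; apply: Sys; exact: map_f.
Qed.
End ConcentratedExt.

(** * The long exact sequence of local cohomology *)

Section Representatives.
Variables (k : fieldType) (s : side) (A : galg k) (i : nat).
Implicit Types M N : gmod s A.

Local Notation res p := (std_res (reg_trunc s A p)).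
Local Notation tmap pq := (std_map (trunc_proj s A pq)).

Definition gamma_cls M p (c : sub_of (cocycles (res p) M i)) : Gamma0 i M :=
  @dl_in k (gamma_sys i M) p (quo_pi (coboundaries (res p) M i) c).

(** Classes are handled through cocycles on the resolution of some truncation. This
    is a relation because a class has representatives at many levels [p]. *)
Definition gamma_rep M p (c : gmor (res p i) M) (x : Gamma0 i M) : Prop :=
  exists c0 : gcomp c (pdiff (res p) i) = 0,
    x = gamma_cls (@mksub _ _ (cocycles (res p) M i) c c0).

Lemma gamma_clsP M (x : Gamma0 i M) : exists p c, x = gamma_cls (p := p) c.
Proof.
by have [p [u ->]] := dl_inP x; exists p, (quo_repr u); rewrite /gamma_cls quo_reprK.
Qed.

Lemma gamma_cls_up M p q (pq : (p <= q)%N) (c : sub_of (cocycles (res p) M i)) :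
  gamma_cls c = gamma_cls (ext_cochain (trunc_proj s A pq) (gid M) c).
Proof.
rewrite /gamma_cls -[in RHS](@Ext0_mapE k s A i _ _ _ _ (trunc_proj s A pq) (gid M)).
exact/esym/(@dl_in_tr k (gamma_sys i M) p q pq).
Qed.

Lemma gamma_cls_linear M p : linear (@gamma_cls M p).
Proof.
move=> a u v; rewrite /gamma_cls quo_pi_linear.
exact: (@dl_in_linear k (gamma_sys i M)).
Qed.

Lemma gamma_rep_cls M p c : gamma_rep (sub_val c) (@gamma_cls M p c).
Proof. by exists (sub_valP c); congr gamma_cls; exact: sub_val_inj. Qed.

Lemma gamma_rep_fun M p c (x y : Gamma0 i M) :
  @gamma_rep M p c x -> gamma_rep c y -> x = y.
Proof. by move=> [c0 ->] [c1 ->]; congr gamma_cls; exact: sub_val_inj. Qed.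

Lemma gamma_rep_ex M (x : Gamma0 i M) : exists p c, @gamma_rep M p c x.
Proof.
by have [p [c ->]] := gamma_clsP x; exists p, (sub_val c); exact: gamma_rep_cls.
Qed.

Lemma gamma_rep_up M p q (pq : (p <= q)%N) c (x : Gamma0 i M) :
  @gamma_rep M p c x -> gamma_rep (gcomp c (tmap pq i)) x.
Proof.
move=> [c0 ->]; rewrite (gamma_cls_up pq).
have := gamma_rep_cls (ext_cochain (trunc_proj s A pq) (gid M)
  (@mksub _ _ (cocycles (res p) M i) c c0)).
by rewrite -[X in gamma_rep X _ -> _]/(gcomp _ _) gcomp_idl.
Qed.

Lemma gamma_rep_exact M p (c : gmor (res p i) M) :
  gcomp c (pdiff (res p) i) = 0 -> exists x, gamma_rep c x.
Proof. by move=> c0; eexists; exists c0. Qed.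

Lemma gamma_rep_cocycle M p (c : gmor (res p i) M) x :
  gamma_rep c x -> gcomp c (pdiff (res p) i) = 0.
Proof. by case. Qed.

Lemma gamma_rep_linear M p a c c' (x x' : Gamma0 i M) :
  @gamma_rep M p c x -> gamma_rep c' x' -> gamma_rep (a *: c + c') (a *: x + x').
Proof.
move=> [c0 ->] [c0' ->]; rewrite -gamma_cls_linear.
exact: (gamma_rep_cls (a *: @mksub _ _ (cocycles (res p) M i) c c0 +
  @mksub _ _ (cocycles (res p) M i) c' c0')).
Qed.

Lemma gamma_rep_map M N (g : gmor M N) p c x :
  @gamma_rep M p c x -> gamma_rep (gcomp g c) (Gamma0_map g x).
Proof.
move=> [c0 ->]; rewrite /gamma_cls Gamma0_mapE Ext0_mapE.
have := gamma_rep_cls (ext_cochain (gid (reg_trunc s A p)) g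
  (@mksub _ _ (cocycles (res p) M i) c c0)).
by rewrite -[X in gamma_rep X _ -> _]/(gcomp _ (gcomp _ _)) std_map_id gcomp_idr.
Qed.

Lemma gamma_rep_coboundary M p c (x : Gamma0 i M) :
  @gamma_rep M p c x -> is_coboundary (P := res p) c -> x = 0.
Proof.
move=> [c0 ->] cB; rewrite -[RHS](lin0 (@gamma_cls_linear M p)) /gamma_cls.
by congr dl_in; apply/quo_piE; rewrite subr0.
Qed.

(** Vanishing in the direct limit need not hold at level [p]; it shows only after
    restriction to a deeper truncation. *)
Lemma gamma_rep0 M p c : @gamma_rep M p c 0 ->
  exists q (pq : (p <= q)%N), is_coboundary (P := res q) (gcomp c (tmap pq i)).
Proof.
move=> [c0 /esym]; rewrite -[RHS](lin0 (@gamma_cls_linear M p)).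
move/dl_inE => [q [pq [pq' e]]]; exists q, pq; move: e.
rewrite -[dtr pq _]/(Ext0_map (i := i) (trunc_proj s A pq) (gid M) _).
rewrite -[dtr pq' _]/(Ext0_map (i := i) (trunc_proj s A pq') (gid M) _).
rewrite (lin0 (@quo_pi_linear _ _ _)) (lin0 (@Ext0_map_linear _ _ _ _ _ _ _ _ _ _)).
rewrite Ext0_mapE -(lin0 (@quo_pi_linear _ _ (coboundaries (res q) M i))) => /quo_piE.
by rewrite subr0 -[X in X -> _]/(is_coboundary (gcomp _ _)) gcomp_idl.
Qed.
End Representatives.

Section Connecting.
Variables (k : fieldType) (s : side) (A : galg k).
Implicit Types K F M : gmod s A.

Local Notation res p := (std_res (reg_trunc s A p)).
Local Notation tmap pq := (std_map (trunc_proj s A pq)).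

(** The connecting map, as a graph: with no choice made of the lift [c], linearity
    and naturality hold on the nose. *)
Definition connects K F M (f : gmor K F) (g : gmor F M) (i : nat)
    (x : Gamma0 i M) (y : Gamma0 i.+1 K) : Prop :=
  exists p (c : gmor (res p i) F) (b : gmor (res p i.+1) K),
    [/\ gamma_rep (gcomp g c) x, gamma_rep b y & gcomp f b = gcomp c (pdiff (res p) i)].

Section Exactness.
Variables (K F M : gmod s A) (f : gmor K F) (g : gmor F M) (i : nat).
Hypothesis fg : short_exact f g.

Lemma connects_up p q (pq : (p <= q)%N) (c : gmor (res p i) F) (b : gmor (res p i.+1) K) :
  gcomp f b = gcomp c (pdiff (res p) i) ->
  gcomp f (gcomp b (tmap pq i.+1)) = gcomp (gcomp c (tmap pq i)) (pdiff (res q) i).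
Proof. by move=> e; rewrite gcompA e -[RHS]gcompA std_map_diff gcompA. Qed.

Lemma connects_linear : @linear_rel k _ _ (connects f g (i := i)).
Proof.
move=> a x x' y y' [p [c [b [cx b_y e]]]] [q [c' [b' [c'x' b'_y' e']]]].
have pm := leq_maxl p q; have qm := leq_maxr p q; set m := maxn p q in pm qm.
exists m, (a *: gcomp c (tmap pm i) + gcomp c' (tmap qm i)),
  (a *: gcomp b (tmap pm i.+1) + gcomp b' (tmap qm i.+1)); split.
- have -> : gcomp g (a *: gcomp c (tmap pm i) + gcomp c' (tmap qm i)) =
      a *: gcomp (gcomp g c) (tmap pm i) + gcomp (gcomp g c') (tmap qm i).
    by rewrite -!gcompA; exact: gcomp_linear_r.
  by apply: gamma_rep_linear; exact: gamma_rep_up.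
- by apply: gamma_rep_linear; exact: gamma_rep_up.
have -> := @gcomp_linear_r _ _ _ _ _ _ f a
  (gcomp b (tmap pm i.+1)) (gcomp b' (tmap qm i.+1)).
rewrite (connects_up pm e) (connects_up qm e').
exact/esym/(@gcomp_linear_l _ _ _ _ _ _ (pdiff (res m) i) a).
Qed.

Lemma connects00 : connects f g (0 : Gamma0 i M) (0 : Gamma0 i.+1 K).
Proof.
have r0 N j : gamma_rep (0 : gmor (res 0 j) N) (0 : Gamma0 j N).
  have [|x x0] := @gamma_rep_exact _ _ _ j N 0%N 0; first exact: gcomp0l.
  suff <- : x = 0 by [].
  by apply: gamma_rep_coboundary x0 _; exact: is_coboundary0.
exists 0%N, 0, 0; split=> //; first by rewrite gcomp0r; exact: r0.
by rewrite gcomp0l gcomp0r.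
Qed.

Lemma connects_total x : exists y, connects f g (i := i) x y.
Proof.
have [p [c cx]] := gamma_rep_ex x; have c0 := gamma_rep_cocycle cx.
have [c' c'E] := short_exact_lift c fg (@pres_projective _ _ _ _ (res p) i).
have [b bE] : exists b, gcomp f b = gcomp c' (pdiff (res p) i).
  by apply: short_exact_factor fg _; rewrite gcompA c'E.
have [|y b_y] := @gamma_rep_exact _ _ _ i.+1 K p b.
  apply: (short_exact_mono fg).
  by rewrite gcompA bE -gcompA pdiff_diff !gcomp0r.
by exists y, p, c', b; split=> //; rewrite c'E.
Qed.

(** A bounding cochain of [g c] lifts to [F], and its coboundary [d] has the same
    image as [c]; thus [c - d] takes values in [K]. *)
Lemma coboundary_lift p (c : gmor (res p i) F) :
  is_coboundary (P := res p) (gcomp g c) -> exists d : gmor (res p i) F,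
    [/\ is_coboundary (P := res p) d, gcomp d (pdiff (res p) i) = 0
      & exists b, gcomp f b = c - d].
Proof.
move=> gcB; suff [d [dB gd]] : exists d : gmor (res p i) F,
    is_coboundary (P := res p) d /\ gcomp g d = gcomp g c.
  exists d; split=> //; first exact: is_coboundary_cocycle.
  by apply: short_exact_factor fg _; rewrite gcompBr gd subrr.
case: i c gcB => [|j] c; first by move=> /= gc0; exists 0; rewrite gcomp0r.
move=> [b bE].
have [b' b'E] := short_exact_lift b fg (@pres_projective _ _ _ _ (res p) j).
exists (gcomp b' (pdiff (res p) j)); split; first by exists b'.
by rewrite gcompA b'E.
Qed.

Lemma connects_eq0l y : connects f g (0 : Gamma0 i M) y -> y = 0.
Proof.
move=> [p [c [b [c0 b_y e]]]]; have [q [pq cB]] := gamma_rep0 c0.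
have {b_y} b_y := gamma_rep_up pq b_y; have {e} e := connects_up pq e.
rewrite -gcompA in cB; have [d [_ d0 [a aE]]] := coboundary_lift cB.
apply: gamma_rep_coboundary b_y _; exists a; apply: (short_exact_mono fg).
by rewrite gcompA aE gcompBl d0 subr0 e.
Qed.

Lemma connects_eq0r x :
  connects f g x (0 : Gamma0 i.+1 K) -> exists z, Gamma0_map g z = x.
Proof.
move=> [p [c [b [cx b0 e]]]]; have [q [pq [a aE]]] := gamma_rep0 b0.
have {cx} cx := gamma_rep_up pq cx; have {e} e := connects_up pq e.
have [|z zE] := @gamma_rep_exact _ _ _ i F q (gcomp c (tmap pq i) - gcomp f a).
  by rewrite gcompBl -e -aE gcompA subrr.
exists z; apply: gamma_rep_fun (gamma_rep_map g zE) _.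
by rewrite gcompBr !gcompA (short_exact_comp fg) gcomp0l subr0.
Qed.

Lemma connects_image y :
  Gamma0_map f y = 0 -> exists x, connects f g (i := i) x y.
Proof.
move=> fy0; have [p [b b_y]] := gamma_rep_ex y; have := gamma_rep_map f b_y.
rewrite fy0 => /gamma_rep0[q [pq [c cE]]].
have [|x xE] := @gamma_rep_exact _ _ _ i M q (gcomp g c).
  by rewrite -gcompA cE !gcompA (short_exact_comp fg) !gcomp0l.
exists x, q, c, (gcomp b (tmap pq i.+1)); split=> //; first exact: gamma_rep_up.
by rewrite gcompA -cE.
Qed.

Lemma connects_ker x y : connects f g (i := i) x y -> Gamma0_map f y = 0.
Proof.
move=> [p [c [b [cx b_y e]]]]; apply: gamma_rep_coboundary (gamma_rep_map f b_y) _.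
by exists c.
Qed.

Lemma Gamma0_exact x : Gamma0_map g x = 0 -> exists y : Gamma0 i K, Gamma0_map f y = x.
Proof.
move=> gx0; have [p [c cx]] := gamma_rep_ex x; have := gamma_rep_map g cx.
rewrite gx0 => /gamma_rep0[q [pq]]; rewrite -gcompA => cB.
have {cx} cx := gamma_rep_up pq cx.
have [d [dB d0 [a aE]]] := coboundary_lift cB.
have [|y a_y] := @gamma_rep_exact _ _ _ i K q a.
  apply: (short_exact_mono fg); rewrite gcompA aE gcompBl d0 subr0 gcomp0r.
  exact: gamma_rep_cocycle cx.
exists y; apply/eqP; rewrite -subr_eq0 -opprB oppr_eq0 addrC -scaleN1r; apply/eqP.
apply: gamma_rep_coboundary (gamma_rep_linear (-1) (gamma_rep_map f a_y) cx) _.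
by rewrite aE scaleN1r opprB subrK.
Qed.

Lemma Gamma0_surj : (forall y : Gamma0 i.+1 K, y = 0) ->
  forall x : Gamma0 i M, exists z, Gamma0_map g z = x.
Proof.
move=> K0 x; have [y xy] := connects_total x.
by apply: connects_eq0r; rewrite -(K0 y).
Qed.
End Exactness.

Lemma connects_map K F M K' F' M' (f : gmor K F) (g : gmor F M) (f' : gmor K' F')
    (g' : gmor F' M') (a : gmor K K') (b : gmor F F') (c : gmor M M') i
    (x : Gamma0 i M) (y : Gamma0 i.+1 K) :
  gcomp f' a = gcomp b f -> gcomp g' b = gcomp c g ->
  connects f g x y -> connects f' g' (Gamma0_map c x) (Gamma0_map a y).
Proof.
move=> fa gb [p [u [v [ux vy e]]]]; exists p, (gcomp b u), (gcomp a v); split.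
- by rewrite gcompA gb -gcompA; exact: gamma_rep_map.
- exact: gamma_rep_map.
by rewrite gcompA fa -!gcompA e.
Qed.
End Connecting.

(** * Forms on the top local cohomology *)

Section FiniteSupport.
Variables (k : fieldType) (s : side) (A : galg k).
Implicit Types M N X : gmod s A.

Lemma gmor_sumE M N (I : Type) (r : seq I) (F : I -> gmor M N) l x :
  (\sum_(t <- r) F t) l x = \sum_(t <- r) F t l x.
Proof.
elim: r => [|t r IH]; first by rewrite !big_nil.
by rewrite !big_cons gmorDE IH.
Qed.

Lemma Gamma0_map_sum i M N (I : Type) (r : seq I) (F : I -> gmor M N) (x : Gamma0 i M) :
  Gamma0_map (\sum_(t <- r) F t) x = \sum_(t <- r) Gamma0_map (F t) x.
Proof.
have lin : linear (fun f : gmor M N => Gamma0_map f x : Gamma0 i N).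
  by move=> c f g; exact: Gamma0_map_add.
exact: (lin_sum lin).
Qed.

Lemma Gamma0_map0 i M N (x : Gamma0 i M) : Gamma0_map (0 : gmor M N) x = 0.
Proof.
have lin : linear (fun f : gmor M N => Gamma0_map f x : Gamma0 i N).
  by move=> c f g; exact: Gamma0_map_add.
exact: (lin0 lin).
Qed.

(** If every map from a finitely generated module to [X] is fixed by some map in
    [C], so is every class: its cocycle can be taken to factor through a finitely
    generated module. For [X] free and [C] the projections onto finite partial
    sums, local cohomology is seen to commute with direct sums. *)
Lemma Gamma0_fixed i X (C : gmor X X -> Prop) :
  (forall p, fg_resolution (reg_trunc s A p)) ->
  (forall Q (e : gmor Q X), gfingen Q -> exists E, C E /\ gcomp E e = e) ->
  forall x : Gamma0 i X, exists E, C E /\ Gamma0_map E x = x.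
Proof.
move=> fg CE x; have [p [c cx]] := gamma_rep_ex x.
have [P Pf] := fg p.
have [t [tE /(_ X i c (gamma_rep_cocycle cx))[e [e0 ce]]]] :=
  presolution_comparison P (std_res (reg_trunc s A p)).
have [E [EC Ee]] := CE _ e (Pf i); exists E; split=> //.
apply/eqP; rewrite -subr_eq0 addrC -scaleN1r; apply/eqP.
apply: gamma_rep_coboundary (gamma_rep_linear (-1) cx (gamma_rep_map E cx)) _.
have -> : -1 *: c + gcomp E c =
    -1 *: (c - gcomp e (t i)) + gcomp E (c - gcomp e (t i)).
  rewrite gcompBr [gcomp E (gcomp _ _)]gcompA Ee !scaleN1r opprB.
  by rewrite [RHS]addrC subrKA addrC.
apply: is_coboundaryP => //.
rewrite -[c - _]gcomp_idr.
by apply: (coboundary_comp (t := fun l => gid _)) => // l; exact: gmor_ext.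
Qed.

Lemma shift_short_exact M N P (f : gmor M N) (g : gmor N P) e :
  short_exact f g -> short_exact (shift_map f e) (shift_map g e).
Proof.
by move=> [fI gS ex]; split=> j; [exact: fI | exact: gS | exact: ex].
Qed.

Lemma shift_map_comp M N P (f : gmor M N) (g : gmor N P) e :
  gcomp (shift_map g e) (shift_map f e) = shift_map (gcomp g f) e.
Proof. exact: gmor_ext. Qed.
End FiniteSupport.

Lemma dual_ext (k : fieldType) (V : lmodType k) (u v : dual V) :
  (forall x, sub_val u x = sub_val v x) -> u = v.
Proof. by move=> uv; apply: sub_val_inj; apply/funext. Qed.

Section Evaluation.
Variables (k : fieldType) (A : galg k) (n : nat) (j : int).
Implicit Types M N : gmod Lft A.

Local Notation R := (reg Lft A).
Local Notation T i M := (Gamma0 i (shift M (- j))).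

Fact deg_swap (d p : int) : - j + p - d = - (j + d) + p.
Proof. by rewrite opprD addrAC. Qed.

Section Element.
Variables (M : gmod Lft A) (d : int) (m : M d).

(** The map [x |-> x m] from the algebra to [M]. *)
Definition elt_map : gmor (shift R (- (j + d))) (shift M (- j)).
Proof.
refine (@GMor k Lft A (shift R (- (j + d))) (shift M (- j))
  (fun p x => gact M d (- j + p) (sub_val x) m) _ _).
- by move=> p c u v; exact: (@gact_linear_l _ _ _ M).
move=> p l a x; rewrite /= /regact shift_deg gactM shift_deg.
congr (gact M _ _ (_ * _) m).
by rewrite deg_swap; exact: esym (sub_valP x).
Defined.
End Element.

Lemma elt_map_linear M d (c : k) (m m' : M d) :
  elt_map (c *: m + m') = c *: elt_map m + elt_map m'.
Proof.
apply: gmor_ext => p x; rewrite gmorPE; exact: (@gact_linear_r _ _ _ M).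
Qed.

Lemma elt_map_act M d l a (m : M d) :
  elt_map (gact M d l a m) = gcomp (elt_map m) (rmul Lft a (- (j + l)) (- (j + d))).
Proof.
apply: gmor_ext => p x; rewrite /= gactM /=.
have -> : - (j + d) - - (j + l) = l - d by rewrite opprK addrC shift_deg.
congr (gact M _ _ (_ * _) m).
by rewrite deg_swap; exact: sub_valP x.
Qed.

Lemma elt_map_nat M N (g : gmor M N) d (m : M d) :
  elt_map (g d m) = gcomp (shift_map g (- j)) (elt_map m).
Proof. by apply: gmor_ext => p x; rewrite /= gm_act. Qed.

Section EvalMap.
Variables (M : gmod Lft A) (u : dual (T n M)).

(** [m] is sent to the form [x |-> u (x m)] on the local cohomology of the
    algebra. *)
Definition evalf d (m : M d) : shift (D_Gamma A n) j d :=
  dual_map (Gamma0_map_linear (elt_map m)) u.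

Fact eval_linear d : linear (@evalf d).
Proof.
move=> c m m'; apply: dual_ext => w.
rewrite -[LHS]/(sub_val u (Gamma0_map _ w)) elt_map_linear Gamma0_map_add.
exact: (sub_valP u).
Qed.
Fact eval_act d l a (m : M d) :
  evalf (gact M d l a m) = gact (shift (D_Gamma A n) j) d l a (evalf m).
Proof.
apply: dual_ext => w; rewrite -[LHS]/(sub_val u (Gamma0_map _ w)) elt_map_act.
by rewrite Gamma0_map_comp.
Qed.
Definition eval : gmor M (shift (D_Gamma A n) j) := GMor eval_linear eval_act.

Lemma evalE d (m : M d) w : sub_val (eval d m) w = sub_val u (Gamma0_map (elt_map m) w).
Proof. by []. Qed.
End EvalMap.

Lemma eval_is_linear M : linear (@eval M).
Proof.
move=> c u v; apply: gmor_ext => d m; rewrite gmorPE; apply: dual_ext => w.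
by [].
Qed.

Definition tdual M N (g : gmor M N) (u : dual (T n N)) : dual (T n M) :=
  dual_map (Gamma0_map_linear (shift_map g (- j))) u.

Lemma tdualE M N (g : gmor M N) u x :
  sub_val (tdual g u) x = sub_val u (Gamma0_map (shift_map g (- j)) x).
Proof. by []. Qed.

Lemma eval_nat M N (g : gmor M N) u : eval (tdual g u) = gcomp (eval u) g.
Proof.
apply: gmor_ext => d m; apply: dual_ext => w; rewrite gcompE !evalE tdualE elt_map_nat.
by congr (sub_val u _); rewrite Gamma0_map_comp.
Qed.

Section FreeModule.
Variables (I : choiceType) (deg : I -> int).
Local Notation F := (Defs.free Lft A deg).

(** [coord_in] and [coord] are the inclusions and projections that exhibit the free
    module as a direct sum of shifts of the algebra. *)
Definition coord_in t : gmor (shift R (- (j + deg t))) (shift F (- j)) :=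
  elt_map (Defs.basis Lft A deg t).

Fact coord_homog t p (u : shift F (- j) p) :
  homog_space A (- (j + deg t) + p) (sub_val u t).
Proof.
have [_ uH] := sub_valP u; rewrite -deg_swap; exact: uH.
Qed.

Definition coord t : gmor (shift F (- j)) (shift R (- (j + deg t))).
Proof.
refine (@GMor k Lft A (shift F (- j)) (shift R (- (j + deg t)))
  (fun p u => mksub (@coord_homog t p u)) _ _).
- by move=> p c u v; apply: sub_val_inj.
by move=> p l a u; apply: sub_val_inj; rewrite /= /regact !shift_deg.
Defined.

Lemma coordK t : gcomp (coord t) (coord_in t) = gid _.
Proof.
apply: gmor_ext => p x; apply: sub_val_inj; rewrite /= eqxx mulr1.
by rewrite deg_swap; exact: sub_valP x.
Qed.

Lemma coord_neq t t' : t != t' -> gcomp (coord t) (coord_in t') = 0.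
Proof.
by move=> tt'; apply: gmor_ext => p x; apply: sub_val_inj; rewrite /= (negbTE tt') mulr0.
Qed.

Definition truncation (r : seq I) : gmor (shift F (- j)) (shift F (- j)) :=
  \sum_(t <- r) gcomp (coord_in t) (coord t).

Lemma truncation_id r p (u : shift F (- j) p) : uniq r ->
  (forall t, sub_val u t <> 0 -> t \in r) -> truncation r p u = u.
Proof.
by move=> rU ur; rewrite gmor_sumE [RHS](@free_sum _ _ _ _ _ _ u r).
Qed.

Lemma truncation_fingen Q (e : gmor Q (shift F (- j))) : gfingen Q ->
  exists E, (exists2 r, uniq r & E = truncation r) /\ gcomp E e = e.
Proof.
move=> [q [t tP]].
have /choice[r0 r0P] (a : 'I_q) : exists r : seq I, uniq r /\
    forall t', sub_val (e (tag (t a)) (tagged (t a))) t' <> 0 -> t' \in r.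
  exact: (@free_support _ Lft _ _ deg (- j + tag (t a))).
pose r := undup (flatten [seq r0 a | a <- enum 'I_q]).
have rU : uniq r by exact: undup_uniq.
exists (truncation r); split; first by exists r.
apply/eqP; rewrite -subr_eq0; apply/eqP/gmor_ext => p x.
suff : forall p x, gker (gcomp (truncation r) e - e) p x by apply.
apply: tP => a; rewrite /gker /= -[LHS]/((gcomp (truncation r) e - e) _ _) gmorBE gcompE.
rewrite truncation_id ?subrr // => t' /(r0P a).2 t'r.
by rewrite mem_undup; apply/flattenP; exists (r0 a) => //; apply/map_f; rewrite mem_enum.
Qed.

Hypothesis trunc_fg : forall p, fg_resolution (reg_trunc Lft A p).

(** A class is fixed by some finite truncation, and the other coordinates of a
    truncated class are zero. *)
Lemma free_class_support i (x : T i F) : exists r, uniq r /\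
  (forall t, Gamma0_map (coord t) x <> 0 -> t \in r) /\
  x = \sum_(t <- r) Gamma0_map (coord_in t) (Gamma0_map (coord t) x).
Proof.
have [_ [[r rU ->] rx]] := Gamma0_fixed trunc_fg truncation_fingen x.
exists r; split=> //; split=> [t tx|]; last first.
  rewrite -{1}rx Gamma0_map_sum; apply: eq_bigr => t _; exact: Gamma0_map_comp.
apply: contrapT => /negP tr; apply: tx.
rewrite -{1}rx -Gamma0_map_comp.
have -> : gcomp (coord t) (truncation r) = 0; last exact: Gamma0_map0.
rewrite [LHS](lin_sum (@gcomp_linear_r _ _ _ _ _ _ (coord t))) big_seq big1 // => t' t'r.
by rewrite gcompA coord_neq ?gcomp0l //; apply: contraNneq tr => ->.
Qed.

Lemma free_class_vanish i : (forall e (x : Gamma0 i (shift R e)), x = 0) ->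
  forall x : T i F, x = 0.
Proof.
move=> R0 x; have [r [_ [_ ->]]] := free_class_support x.
rewrite big1 // => t _; rewrite (R0 _ (Gamma0_map _ x)).
exact: lin0 (@Gamma0_map_linear _ _ _ _ _ _ _).
Qed.

Lemma eval_free_inj (u : dual (T n F)) : eval u = 0 -> u = 0.
Proof.
move=> u0; apply: dual_ext => x; have [r [_ [_ ->]]] := free_class_support x.
rewrite (lin_sum (sub_valP u)) big1 ?(lin0 (sub_valP _)) // => t _.
by rewrite -evalE u0.
Qed.

(** The form with prescribed restrictions to the summands is a sum that is finite
    on each class. *)
Lemma eval_free_surj (g : gmor F (shift (D_Gamma A n) j)) : exists u, eval u = g.
Proof.
pose gt t (w : Gamma0 n (shift R (- (j + deg t)))) : k^o :=
  sub_val (g (deg t) (Defs.basis Lft A deg t)) w.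
have gtL t : linear (@gt t) by exact: (sub_valP (g (deg t) (Defs.basis Lft A deg t))).
pose v (x : T n F) : k^o := \sum_(t \in [set: I]%classic) gt t (Gamma0_map (coord t) x).
have vE x r : uniq r -> (forall t, Gamma0_map (coord t) x <> 0 -> t \in r) ->
    v x = \sum_(t <- r) gt t (Gamma0_map (coord t) x).
  move=> rU xr; rewrite fsbig_seq //; apply/esym/fsbig_widen => //.
  move=> t [_ /= /negP tr]; have [->|/xr] := pselect (Gamma0_map (coord t) x = 0).
    exact: lin0 (gtL t).
  by rewrite (negbTE tr).
have vL : linear_forms (T n F) v.
  move=> c x y; have [r [rU [xr _]]] := free_class_support x.
  have [q [qU [yq _]]] := free_class_support y.
  have rq1 t : t \in r -> t \in undup (r ++ q) by rewrite mem_undup mem_cat => ->.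
  have rq2 t : t \in q -> t \in undup (r ++ q) by rewrite mem_undup mem_cat orbC => ->.
  have U := undup_uniq (r ++ q).
  rewrite (vE x _ U) => [|t /xr /rq1//]; rewrite (vE y _ U) => [|t /yq /rq2//].
  rewrite (vE _ _ U) => [|t xyt].
    rewrite scaler_sumr -big_split; apply: eq_bigr => t _ /=.
    by rewrite Gamma0_map_linear gtL.
  have [x0|/xr /rq1//] := pselect (Gamma0_map (coord t) x = 0).
  apply/rq2/yq => y0; apply: xyt.
  by rewrite Gamma0_map_linear x0 y0 scaler0 addr0.
exists (mksub vL); apply: free_ext => t; apply: dual_ext => w.
rewrite evalE /= (vE _ [:: t]) // => [|t' t't].
  by rewrite big_seq1 -Gamma0_map_comp coordK Gamma0_map_id.
rewrite inE; have [//|tt'] := eqVneq t' t; case: t't.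
by rewrite -Gamma0_map_comp coord_neq // Gamma0_map0.
Qed.
End FreeModule.

Section RightExact.
Hypothesis trunc_fg : forall p, fg_resolution (reg_trunc Lft A p).
Hypothesis top : forall M (x : T n.+1 M), x = 0.

Lemma gamma_top_surj M N (g : gmor M N) : gsurj g ->
  forall x : T n N, exists y : T n M, Gamma0_map (shift_map g (- j)) y = x.
Proof.
move=> gS; have ex := shift_short_exact (- j) (gker_short_exact gS).
exact: Gamma0_surj ex (top (M := _)).
Qed.

Lemma eval_inj M (u : dual (T n M)) : eval u = 0 -> u = 0.
Proof.
move=> u0; have u'0 : tdual (cover_aug M) u = 0.
  by apply: eval_free_inj => //; rewrite eval_nat u0 gcomp0l.
apply: dual_ext => x; have [y <-] := gamma_top_surj (@cover_aug_surj _ _ _ M) x.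
exact: (congr1 (fun v : dual _ => sub_val v y) u'0).
Qed.

(** Let [F1 -> F0 -> M -> 0] be exact with free terms. The composite [F0 -> M -> D]
    comes from a form on the local cohomology of [F0]; this form is zero on that of
    [F1], by injectivity for [F1], so it descends to that of [M]. *)
Lemma eval_surj M (g : gmor M (shift (D_Gamma A n) j)) : exists u, eval u = g.
Proof.
pose q := cover_aug M; pose K := gker q; pose q' := cover_aug (gsubmod K).
have qS : gsurj q := @cover_aug_surj _ _ _ M.
have q'S : gsurj q' := @cover_aug_surj _ _ _ (gsubmod K).
have [u0 u0E] := eval_free_surj trunc_fg (gcomp g q).
have qK : gcomp q (gincl K) = 0 := short_exact_comp (gker_short_exact qS).
have u0K : tdual (gcomp (gincl K) q') u0 = 0.
  apply: eval_free_inj => //; rewrite eval_nat u0E -gcompA [gcomp q _]gcompA qK.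
  by rewrite gcomp0l gcomp0r.
have ex := shift_short_exact (- j) (gker_short_exact qS).
have qL := @Gamma0_map_linear _ _ _ n _ _ (shift_map q (- j)).
have [|||u uE] := @dual_extension _ (T n M) (T n (Defs.cover M))
  (fun x y => Gamma0_map (shift_map q (- j)) x = y) u0.
- by move=> c x x' _ _ <- <-; exact: qL.
- exact: lin0 qL.
- move=> _ /(Gamma0_exact ex)[z <-]; have [z' <-] := gamma_top_surj q'S z.
  rewrite -Gamma0_map_comp shift_map_comp.
  exact: (congr1 (fun v : dual _ => sub_val v z') u0K).
exists u; apply: (gsurj_epi qS); rewrite -eval_nat -u0E; congr eval.
by apply: dual_ext => x; rewrite (uE x _ erefl).
Qed.
End RightExact.
End Evaluation.

(** * Dimension shifting and Ext classes *)

Section SyzygyClasses.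
Variables (k : fieldType) (s : side) (A : galg k) (m : nat).
Implicit Types M N : gmod s A.

Section Class.
Variables (M N : gmod s A).

Fact syz_cocycle (c : gmor (syz m M) N) :
  gcomp (gcomp c (cover_aug (syz m M))) (pdiff (std_res M) m) = 0.
Proof.
apply: gmor_ext => l x; rewrite !gcompE.
have -> : cover_aug (syz m M) l (pdiff (std_res M) m l x) = 0.
  by apply/std_diff_im; exists x.
exact: gmor0.
Qed.

Definition syz_cochain (c : gmor (syz m M) N) : sub_of (cocycles (std_res M) N m) :=
  @mksub _ _ (cocycles (std_res M) N m) _ (syz_cocycle c).

(** A cocycle on the [m]-th term of the standard resolution kills the next syzygy,
    hence is a map on the [m]-th one: maps on the syzygy represent Ext^m. *)
Definition syz_class (c : gmor (syz m M) N) : Ext0 m M N :=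
  quo_pi (coboundaries (std_res M) N m) (syz_cochain c).

Lemma syz_class_linear : linear syz_class.
Proof.
move=> a b c; rewrite /syz_class -quo_pi_linear; congr quo_pi; apply: sub_val_inj.
exact: (@gcomp_linear_l _ _ _ _ _ _ (cover_aug (syz m M))).
Qed.

Lemma syz_class_surj (e : Ext0 m M N) : exists c, e = syz_class c.
Proof.
have c0 := sub_valP (quo_repr e); set c := sub_val _ in c0.
have [|c' c'E] :=
  @gsurj_factor _ _ _ _ _ _ (cover_aug (syz m M)) c (@cover_aug_surj _ _ _ _).
  by move=> l x /std_diff_im[y <-]; exact: (gcomp_app c0).
exists c'; rewrite -[LHS]quo_reprK; congr quo_pi; apply: sub_val_inj.
exact: esym c'E.
Qed.
End Class.

Lemma syz_class_map M M' N (f : gmor M M') (c : gmor (syz m M') N) :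
  Ext0_map f (gid N) (syz_class c) = syz_class (gcomp c (syz_map m f)).
Proof.
rewrite /syz_class Ext0_mapE; congr quo_pi; apply: sub_val_inj.
rewrite -[LHS]/(gcomp (gid N) (gcomp (gcomp c _) (cover_map (syz_map m f)))).
by rewrite gcomp_idl -gcompA cover_map_aug gcompA.
Qed.
End SyzygyClasses.

(** The coboundaries are the maps that extend to the cover containing the syzygy. *)
Lemma syz_class_eq0 (k : fieldType) (s : side) (A : galg k) m (M N : gmod s A)
    (c : gmor (syz m.+1 M) N) : syz_class c = 0 <->
  exists b : gmor (Defs.cover (syz m M)) N,
    gcomp b (gincl (gker (cover_aug (syz m M)))) = c.
Proof.
rewrite /syz_class.
rewrite -[X in _ = X](lin0 (@quo_pi_linear _ _ (coboundaries (std_res M) N m.+1))).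
rewrite quo_piE subr0; split=> -[b bE]; exists b.
  apply: (gsurj_epi (@cover_aug_surj _ _ _ (syz m.+1 M))).
  by rewrite -gcompA; exact: bE.
by rewrite /= -bE gcompA.
Qed.

Lemma syz_class0_eq0 (k : fieldType) (s : side) (A : galg k) (M N : gmod s A)
    (c : gmor (syz 0 M) N) : syz_class c = 0 <-> c = 0.
Proof.
split=> [|->]; last exact: lin0 (@syz_class_linear _ _ _ 0 M N).
rewrite /syz_class.
rewrite -[X in _ = X](lin0 (@quo_pi_linear _ _ (coboundaries (std_res M) N 0))).
move/quo_piE; rewrite subr0 => e.
by apply: (gsurj_epi (@cover_aug_surj _ _ _ M)); rewrite gcomp0l; exact: e.
Qed.

Section IteratedConnecting.
Variables (k : fieldType) (A : galg k) (j : int) (i : nat).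
Implicit Types M : gmod Lft A.

Local Notation T l M := (Gamma0 l (shift M (- j))).
Local Notation syz_in m M := (shift_map (gincl (gker (cover_aug (syz m M)))) (- j)).
Local Notation syz_aug m M := (shift_map (cover_aug (syz m M)) (- j)).

Lemma syz_short_exact m M : short_exact (syz_in m M) (syz_aug m M).
Proof. exact/shift_short_exact/gker_short_exact/cover_aug_surj. Qed.

(** Dimension shifting: the composite of [m] connecting maps, along the successive
    syzygies. *)
Fixpoint iconnects (m : nat) M (x : T i M) : T (m + i) (syz m M) -> Prop :=
  match m return T (m + i) (syz m M) -> Prop with
  | 0%N => fun y => x = y
  | m'.+1 => fun y => exists z, iconnects x z /\
      connects (syz_in m' M) (syz_aug m' M) (i := m' + i) z y
  end.

(** The image of the iterated connecting map: everything for [m = 0], otherwise a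
    kernel, by the last step. *)
Definition dies_in_cover (m : nat) M : T (m + i) (syz m M) -> Prop :=
  match m return T (m + i) (syz m M) -> Prop with
  | 0%N => fun _ => True
  | m'.+1 => fun y => Gamma0_map (syz_in m' M) y = 0
  end.

Lemma iconnects_total m M (x : T i M) : exists y, iconnects (m := m) x y.
Proof.
elim: m => [|m [z xz]]; first by exists x.
by have [y zy] := connects_total (syz_short_exact m M) z; exists y, z.
Qed.

Lemma iconnects_linear m M : @linear_rel k _ _ (@iconnects m M).
Proof.
move=> a x x'; elim: m => [|m IH] y y' /=; first by move=> -> ->.
move=> [z [xz zy]] [z' [xz' zy']]; exists (a *: z + z'); split; first exact: IH.
exact: connects_linear.
Qed.

Lemma iconnects00 m M : iconnects (m := m) (0 : T i M) 0.
Proof.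
by elim: m => [|m IH] //=; exists 0; split=> //; exact: connects00.
Qed.

Lemma iconnects_eq0l m M y : iconnects (m := m) (0 : T i M) y -> y = 0.
Proof.
elim: m y => [|m IH] y /=; first by move=> <-.
by move=> [z [/IH -> ]]; exact: connects_eq0l (syz_short_exact m M) _.
Qed.

Lemma iconnects_dies m M (x : T i M) y : iconnects (m := m) x y -> dies_in_cover y.
Proof.
by case: m y => [|m] y //= [z [_]]; exact: connects_ker.
Qed.

Lemma iconnects_map m M M' (f : gmor M M') (x : T i M) y : iconnects (m := m) x y ->
  iconnects (Gamma0_map (shift_map f (- j)) x)
    (Gamma0_map (shift_map (syz_map m f) (- j)) y).
Proof.
elim: m y => [|m IH] y /=; first by move=> <-.
move=> [z [xz zy]]; exists (Gamma0_map (shift_map (syz_map m f) (- j)) z).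
split; first exact: IH.
apply: (connects_map (b := shift_map (cover_map (syz_map m f)) (- j))) zy.
  exact: gmor_ext.
by rewrite !shift_map_comp cover_map_aug.
Qed.

Variable b : nat.
Hypothesis cover_vanish : forall l M, (l < b)%N -> forall x : T l (Defs.cover M), x = 0.

Lemma iconnects_eq0r m M (x : T i M) :
  (m + i <= b)%N -> iconnects (m := m) x 0 -> x = 0.
Proof.
elim: m => [|m IH] mb //= [z [xz /(connects_eq0r (syz_short_exact m M))[t tz]]].
apply: IH; first exact: ltnW.
by move: xz; rewrite -tz (cover_vanish mb t) (lin0 (@Gamma0_map_linear _ _ _ _ _ _ _)).
Qed.

Lemma iconnects_image m M (y : T (m + i) (syz m M)) :
  (m + i <= b)%N -> dies_in_cover y -> exists x, iconnects x y.
Proof.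
elim: m y => [|m IH] y mb y0; first by exists y.
have [z zy] := connects_image (syz_short_exact m M) y0.
have dies (z' : T (m + i) (syz m M)) : dies_in_cover z'.
  by case: m mb z' {IH y y0 z zy} => [|m] mb z' //=; exact: cover_vanish.
by have [||x xz] := IH z; [exact: ltnW| |exists x, z].
Qed.
End IteratedConnecting.

Section Duality.
Variables (k : fieldType) (A : galg k) (j : int) (m i : nat).
Implicit Types M : gmod Lft A.

Local Notation T l M := (Gamma0 l (shift M (- j))).
Local Notation D := (shift (D_Gamma A (m + i)) j).

Hypothesis trunc_fg : forall p, fg_resolution (reg_trunc Lft A p).
Hypothesis top : forall M (x : T (m + i).+1 M), x = 0.
Hypothesis cover_vanish :
  forall l M, (l < m + i)%N -> forall x : T l (Defs.cover M), x = 0.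

(** The graph of the isomorphism of the theorem: a form on local cohomology is
    carried by dimension shifting to the top local cohomology of a syzygy, where
    evaluation makes it a map on the syzygy, that is, an Ext class. *)
Definition duality M (u : dual (T i M)) (e : Ext0 m M D) : Prop :=
  exists w : dual (T (m + i) (syz m M)),
    (forall x y, iconnects x y -> sub_val u x = sub_val w y) /\
    e = syz_class (eval w).

Lemma duality_total M (u : dual (T i M)) : exists e, duality u e.
Proof.
have [||w wE] := @dual_extension _ _ _ _ u (@iconnects_linear _ A j i m M).
- exact: iconnects00.
- by move=> x /(iconnects_eq0r cover_vanish (leqnn _)) ->; exact: lin0 (sub_valP u).
by exists (syz_class (eval w)), w.
Qed.

Lemma duality_surj M (e : Ext0 m M D) : exists u : dual (T i M), duality u e.
Proof.
have [c ->] := syz_class_surj e; have [w <-] := eval_surj trunc_fg top c.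
have [|||u uE] := @dual_extension _ (T i M) _ (fun y x => iconnects x y) w.
- by move=> a y y' x x'; exact: iconnects_linear.
- exact: iconnects00.
- by move=> y /iconnects_eq0l ->; exact: lin0 (sub_valP w).
by exists u, w; split=> // x y xy; rewrite (uE _ _ xy).
Qed.

Lemma duality_linear M : @linear_rel k _ _ (@duality M).
Proof.
move=> a u u' e e' [w [uw ->]] [w' [uw' ->]]; exists (a *: w + w'); split.
  move=> x y xy.
  change (a * sub_val u x + sub_val u' x = a * sub_val w y + sub_val w' y).
  by rewrite (uw _ _ xy) (uw' _ _ xy).
by rewrite eval_is_linear syz_class_linear.
Qed.

(** [w] vanishes on the classes of the syzygy that die in the cover, so it is the
    restriction of a form [v] on the local cohomology of the cover; evaluating [v]
    extends the map on the syzygy to the cover. *)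
Lemma duality_eq0l M (e : Ext0 m M D) : duality (0 : dual (T i M)) e -> e = 0.
Proof.
move=> [w [w0 ->]].
have {}w0 y : dies_in_cover y -> sub_val w y = 0.
  by move=> /(iconnects_image cover_vanish (leqnn _))[x xy]; rewrite -(w0 _ _ xy).
move: (m) w w0 => [|m'] w w0.
  have -> : w = 0 by apply: dual_ext => y; exact: w0.
  by rewrite (lin0 (@eval_is_linear _ _ _ _ _)); exact/syz_class0_eq0.
apply/syz_class_eq0; set g := gincl _.
have gL := @Gamma0_map_linear _ _ _ (m'.+1 + i) _ _ (shift_map g (- j)).
have [|||v vE] := @dual_extension _ _ _
  (fun y x => Gamma0_map (shift_map g (- j)) y = x) w.
- by move=> a y y' _ _ <- <-; exact: gL.
- exact: lin0 gL.
- exact: w0.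
exists (eval v); rewrite -eval_nat; congr eval; apply: dual_ext => y.
by rewrite tdualE (vE y _ erefl).
Qed.

(** Conversely an extension of the map to the cover is the evaluation of a form
    [v], and [w] is then zero on whatever dies in the cover. *)
Lemma duality_eq0r M (u : dual (T i M)) : duality u 0 -> u = 0.
Proof.
move=> [w [uw /esym w0]]; apply: dual_ext => x.
have [y xy] := iconnects_total m x; rewrite (uw _ _ xy).
have y0 := iconnects_dies xy.
move: (m) w w0 y y0 {uw xy} trunc_fg top => [|m'] w w0 y y0 fg tp.
  by rewrite (eval_inj fg tp (iffLR (syz_class0_eq0 _) w0)).
have [b bE] := iffLR (syz_class_eq0 _) w0; have [v vb] := eval_surj fg tp b.
have -> : w = tdual (gincl _) v.
  apply/eqP; rewrite -subr_eq0; apply/eqP/(eval_inj fg tp).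
  by rewrite (linB (@eval_is_linear _ _ _ _ _)) eval_nat vb bE subrr.
by rewrite tdualE y0; exact: lin0 (sub_valP v).
Qed.

Lemma duality_map M M' (f : gmor M M') (u : dual (T i M')) e : duality u e ->
  duality (dual_map (Gamma0_map_linear (shift_map f (- j))) u) (Ext0_map f (gid D) e).
Proof.
move=> [w [uw ->]]; exists (tdual (syz_map m f) w); split.
  by move=> x y /(iconnects_map f) /uw.
by rewrite eval_nat syz_class_map.
Qed.
End Duality.

(** * The duality for Gorenstein algebras *)

Section Gorenstein.
Variables (k : fieldType) (A : galg k) (n : nat).
Hypothesis A_Gorenstein : AS_Gorenstein A n.
Hypothesis left_resolutions : forall S : gmod Lft A, gsimple S -> fg_resolution S.

Lemma trunc_ext_concentrated p : fg_ext_concentrated n (reg_trunc Lft A p).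
Proof.
apply: fg_ext_concentrated_trunc => S S_simple S0.
have [P Pf] := left_resolutions S_simple.
have [ext0 _ _ _] := A_Gorenstein S_simple S0.
exists P; split=> // i e ni.
by apply: (ext_vanishes_indep (P := std_res S)); apply/ext_vanishesP; exact: ext0.
Qed.

Lemma trunc_fg_resolution p : fg_resolution (reg_trunc Lft A p).
Proof. by have [P [Pf _]] := trunc_ext_concentrated p; exists P. Qed.

Lemma gamma_cover_vanish i (M : gmod Lft A) e (x : Gamma0 i (shift (Defs.cover M) e)) :
  i <> n -> x = 0.
Proof.
move=> ni; rewrite -[e]opprK in x *; apply: free_class_vanish x => [p|d x].
  exact: trunc_fg_resolution.
have [p [c ->]] := gamma_clsP x; have [P [_ Pv]] := trunc_ext_concentrated p.
apply: gamma_rep_coboundary (gamma_rep_cls c) _.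
exact: (ext_vanishes_indep (Pv i d ni)) (sub_valP c).
Qed.

Hypothesis A_lcd : finite_left_lcd A.

(** Descending induction from the local cohomology dimension: above [n], covers have
    no cohomology, and the class on [M] is controlled by the next degree of the
    syzygy. *)
Lemma gamma_above_vanish l (M : gmod Lft A) e (x : Gamma0 l (shift M e)) :
  (n < l)%N -> x = 0.
Proof.
have [l0 lcd] := A_lcd; have [d] : exists d, (l0 < l + d)%N.
  by exists l0.+1; rewrite ltn_addl.
elim: d l M x => [|d IH] l M x ld nl.
  by rewrite addn0 in ld; exact: (lcd M l ld e x).
have ex := shift_short_exact e (gker_short_exact (@cover_aug_surj _ _ _ M)).
have [|z <-] := Gamma0_surj ex _ x.
  by move=> y; apply: IH; [rewrite addSnnS | exact: ltnW].
have -> : z = 0 by apply: gamma_cover_vanish => ln; rewrite ln ltnn in nl.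
exact: lin0 (@Gamma0_map_linear _ _ _ _ _ _ _).
Qed.
End Gorenstein.

Lemma inj_surj_bijective (S T : Type) (f : S -> T) :
  injective f -> (forall y, exists x, f x = y) -> bijective f.
Proof. by move=> fI /choice[g gK]; exists g => // x; apply: fI. Qed.

Theorem theorem2 (k : fieldType) (A : galg k) (n : nat)
    (A_Gorenstein : AS_Gorenstein A n)
    (left_resolutions : forall S : gmod Lft A, gsimple S -> fg_resolution S)
    (right_resolutions : forall S : gmod Rgt A, gsimple S -> fg_resolution S)
    (A_lcd : finite_left_lcd A) :
  forall i : nat, (i <= n)%N ->
  exists phi : forall (M : gmod Lft A) (j : int),
      gdual (Gamma i M) j -> Ext (n - i) M (D_Gamma A n) j,
    [/\ forall M j, linear (phi M j),
        forall M j, bijective (phi M j)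
      & forall (M M' : gmod Lft A) (f : gmor M M') (j : int)
          (u : gdual (Gamma i M') j),
        phi M j (gdual_map (fun d => @Gamma_map_linear k Lft A i M M' f d) u) =
        Ext_map f (phi M' j u)].
Proof.
move=> i le_i_n; have : n = (n - i + i)%N by rewrite subnK.
move: (n - i)%N {le_i_n} => m n_eq; subst n.
have fg := trunc_fg_resolution A_Gorenstein left_resolutions.
have top j (M : gmod Lft A) (x : Gamma0 (m + i).+1 (shift M (- j))) : x = 0.
  exact: (gamma_above_vanish A_Gorenstein left_resolutions A_lcd) (ltnSn _).
have low j l (M : gmod Lft A) : (l < m + i)%N ->
    forall x : Gamma0 l (shift (Defs.cover M) (- j)), x = 0.
  move=> lmi x; apply: (gamma_cover_vanish A_Gorenstein left_resolutions) => ln.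
  by rewrite ln ltnn in lmi.
pose phi (M : gmod Lft A) j (u : gdual (Gamma i M) j) : Ext m M (D_Gamma A (m + i)) j :=
  sval (cid (duality_total (@low j) u)).
have phiP (M : gmod Lft A) j (u : gdual (Gamma i M) j) : duality u (phi M j u).
  exact: svalP (cid (duality_total (@low j) u)).
have phiE (M : gmod Lft A) j (u : gdual (Gamma i M) j) e : duality u e -> phi M j u = e.
  move=> ue; have := duality_linear (-1) ue (phiP M j u).
  rewrite !scaleN1r addNr => /(duality_eq0l (@low j))/eqP.
  by rewrite addrC subr_eq0 => /eqP.
have phiL (M : gmod Lft A) j : linear (phi M j).
  by move=> c u v; apply: phiE; exact: duality_linear.
exists phi; split=> // [M j|M M' f j u]; last first.
  by apply: phiE; exact: duality_map.
apply: inj_surj_bijective => [u v uv|e].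
  apply/eqP; rewrite -subr_eq0; apply/eqP/(duality_eq0r fg (@top j)).
  by rewrite -(subrr (phi M j v)) -{1}uv -(linB (phiL M j)).
by have [u ue] := duality_surj fg (@top j) e; exists u; exact: phiE.
Qed.
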